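(* Consider the linear regression model $\boldsymbol{Y}=\boldsymbol{X}\boldsymbol{\beta}+\boldsymbol{\varepsilon}$, where $\boldsymbol{X}$ is a known $n\times p$ matrix with linearly independent columns ($n>p$) and $\boldsymbol{\varepsilon}\sim N(\boldsymbol{0},\sigma^2\boldsymbol{I}_n)$, $\sigma^2>0$ unknown. Let $\theta=\boldsymbol{a}^T\boldsymbol{\beta}$ ($\boldsymbol{a}\neq\boldsymbol{0}$ given), $\boldsymbol{\tau}=\boldsymbol{C}^T\boldsymbol{\beta}-\boldsymbol{t}$ with $\boldsymbol{C}$ a given $p\times s$ matrix ($s<p$) of linearly independent columns, $\boldsymbol{t}$ a given $s$-vector, and $\boldsymbol{a}$ not in the column span of $\boldsymbol{C}$. Let $\hat{\boldsymbol{\beta}}$ be the least squares estimator, $\hat\Sigma^2=\|\boldsymbol{Y}-\boldsymbol{X}\hat{\boldsymbol{\beta}}\|^2/(n-p)$, $\hat\Theta=\boldsymbol{a}^T\hat{\boldsymbol{\beta}}$, $\hat{\boldsymbol{\tau}}=\boldsymbol{C}^T\hat{\boldsymbol{\beta}}-\boldsymbol{t}$, and assume $E\big((\hat{\boldsymbol{\tau}}-\boldsymbol{\tau})(\hat\Theta-\theta)\big)=\boldsymbol{0}$. Let $m=n-p$, $v_{11}=\boldsymbol{a}^T(\boldsymbol{X}^T\boldsymbol{X})^{-1}\boldsymbol{a}$, $\boldsymbol{V}_{22}=\boldsymbol{C}^T(\boldsymbol{X}^T\boldsymbol{X})^{-1}\boldsymbol{C}$, $t(m)$ such that $P(-t(m)\le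 T\le t(m))=1-\alpha$ for $T\sim t_m$, and $F=\big(\hat{\boldsymbol{\tau}}^T\boldsymbol{V}_{22}^{-1}\hat{\boldsymbol{\tau}}/s\big)/\hat\Sigma^2$. For a continuous function $d:[0,\infty)\to(0,\infty)$ with $d(x)=t(m)$ for all $x\ge k$ ($k>0$ specified), let $J(d)=[\hat\Theta-\sqrt{v_{11}}\hat\Sigma d(\sqrt F),\ \hat\Theta+\sqrt{v_{11}}\hat\Sigma d(\sqrt F)]$ and $I=[\hat\Theta-t(m)\sqrt{v_{11}}\hat\Sigma,\ \hat\Theta+t(m)\sqrt{v_{11}}\hat\Sigma]$. Let $e(0;d)$ denote the scaled expected length $E(\text{length of }J(d))/E(\text{length of }I)$ evaluated at $\boldsymbol{\tau}=\boldsymbol{0}$, and let $W=\hat\Sigma/\sigma$ (which has the distribution of $\sqrt{\chi^2_m/m}$). Then $$e(0;d)=1+\frac{2^{3/2}\,s^{s/2}\,\Gamma((s+m+1)/2)}{t(m)\,E(W)\,\Gamma(m/2)\,\Gamma(s/2)}\int_0^k\big(d(x)-t(m)\big)\,x^{s-1}\,\frac{m^{m/2}}{(sx^2+m)^{(s+m+1)/2}}\,dx,$$ where $\Gamma$ is the gamma function.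
   Context: $0<\alpha<1$. *)

(* Defs.v *)
From HB Require Import structures.
From mathcomp Require Import all_boot all_order all_algebra.
From mathcomp Require Import all_classical all_reals all_analysis.
From mathcomp Require Import normal_distribution.
Set Implicit Arguments. Unset Strict Implicit. Unset Printing Implicit Defensive.
Import Order.TTheory GRing.Theory Num.Theory.
Import numFieldNormedType.Exports.
Local Open Scope classical_set_scope.
Local Open Scope ring_scope.

Section defs.
Context {R : realType}.

Definition Gamma (x : R) : R :=
  Rintegral lebesgue_measure `]0%R, +oo[ (fun t : R => t `^ (x - 1) * expR (- t)).

Definition student_pdf (m : nat) (x : R) : R :=
  Gamma ((m%:R + 1) / 2) / (Num.sqrt (m%:R * pi) * Gamma (m%:R / 2))
  * (1 + x ^+ 2 / m%:R) `^ (- ((m%:R + 1) / 2)).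

Definition model_Y {d} {T : measurableType d} {n p : nat}
  (X : 'M[R]_(n, p)) (beta : 'cV[R]_p) (eps : 'I_n -> T -> R) (w : T) : 'cV[R]_n :=
  X *m beta + \col_i eps i w.

Definition XtXinv {n p} (X : 'M[R]_(n, p)) : 'M[R]_p := invmx (X^T *m X).

Definition betahat {n p} (X : 'M[R]_(n, p)) (Y : 'cV[R]_n) : 'cV[R]_p :=
  XtXinv X *m X^T *m Y.

Definition Sigmahat2 {n p} (X : 'M[R]_(n, p)) (Y : 'cV[R]_n) : R :=
  (\sum_i ((Y - X *m betahat X Y) i 0) ^+ 2) / (n - p)%:R.

Definition Sigmahat {n p} (X : 'M[R]_(n, p)) (Y : 'cV[R]_n) : R :=
  Num.sqrt (Sigmahat2 X Y).

Definition Thetahat {n p} (a : 'cV[R]_p) (X : 'M[R]_(n, p)) (Y : 'cV[R]_n) : R :=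
  (a^T *m betahat X Y) 0 0.

Definition tauhat {n p s} (C : 'M[R]_(p, s)) (t : 'cV[R]_s)
  (X : 'M[R]_(n, p)) (Y : 'cV[R]_n) : 'cV[R]_s :=
  C^T *m betahat X Y - t.

Definition v11 {n p} (a : 'cV[R]_p) (X : 'M[R]_(n, p)) : R :=
  (a^T *m XtXinv X *m a) 0 0.

Definition V22 {n p s} (C : 'M[R]_(p, s)) (X : 'M[R]_(n, p)) : 'M[R]_s :=
  C^T *m XtXinv X *m C.

Definition Fstat {n p s} (C : 'M[R]_(p, s)) (t : 'cV[R]_s)
  (X : 'M[R]_(n, p)) (Y : 'cV[R]_n) : R :=
  (((tauhat C t X Y)^T *m invmx (V22 C X) *m tauhat C t X Y) 0 0 / s%:R)
  / Sigmahat2 X Y.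

Definition J_lo {n p s} (a : 'cV[R]_p) (C : 'M[R]_(p, s)) (t : 'cV[R]_s)
  (dd : R -> R) (X : 'M[R]_(n, p)) (Y : 'cV[R]_n) : R :=
  Thetahat a X Y - Num.sqrt (v11 a X) * Sigmahat X Y * dd (Num.sqrt (Fstat C t X Y)).
Definition J_hi {n p s} (a : 'cV[R]_p) (C : 'M[R]_(p, s)) (t : 'cV[R]_s)
  (dd : R -> R) (X : 'M[R]_(n, p)) (Y : 'cV[R]_n) : R :=
  Thetahat a X Y + Num.sqrt (v11 a X) * Sigmahat X Y * dd (Num.sqrt (Fstat C t X Y)).
Definition I_lo {n p} (a : 'cV[R]_p) (tm : R) (X : 'M[R]_(n, p)) (Y : 'cV[R]_n) : R :=
  Thetahat a X Y - tm * Num.sqrt (v11 a X) * Sigmahat X Y.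
Definition I_hi {n p} (a : 'cV[R]_p) (tm : R) (X : 'M[R]_(n, p)) (Y : 'cV[R]_n) : R :=
  Thetahat a X Y + tm * Num.sqrt (v11 a X) * Sigmahat X Y.

Definition Expect {d} {T : measurableType d} (P : probability T R) (f : T -> R) : R :=
  Rintegral P setT f.

Definition scaled_exp_length {d} {T : measurableType d} (P : probability T R)
  {n p s} (a : 'cV[R]_p) (C : 'M[R]_(p, s)) (t : 'cV[R]_s) (dd : R -> R) (tm : R)
  (X : 'M[R]_(n, p)) (Y : T -> 'cV[R]_n) : R :=
  Expect P (fun w => J_hi a C t dd X (Y w) - J_lo a C t dd X (Y w))
  / Expect P (fun w => I_hi a tm X (Y w) - I_lo a tm X (Y w)).

Definition mutually_independent {d} {T : measurableType d} (P : probability T R)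
  {n} (eps : 'I_n -> T -> R) : Prop :=
  forall B : 'I_n -> set R, (forall i, measurable (B i)) ->
    P [set w | forall i, B i (eps i w)] = (\prod_(i < n) P (eps i @^-1` B i))%E.

(* eps ~ N(0, sigma^2 I_n) : iid N(0, sigma^2) components *)
Definition normal_iid_vector {d} {T : measurableType d} (P : probability T R)
  {n} (sigma : R) (eps : 'I_n -> T -> R) : Prop :=
  [/\ forall i, measurable_fun setT (eps i),
      forall i (B : set R), measurable B -> P (eps i @^-1` B) = normal_prob 0 sigma B
    & mutually_independent P eps].

End defs.

(* Main.v *)
Require Import Defs.
From HB Require Import structures.
From mathcomp Require Import all_boot all_order all_algebra.
From mathcomp Require Import all_classical all_reals all_analysis.
From mathcomp Require Import normal_distribution.
From mathcomp Require Import measurable_realfun ring lra.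
Import Order.TTheory GRing.Theory Num.Theory.
Import numFieldNormedType.Exports.
Local Open Scope classical_set_scope.
Local Open Scope ring_scope.

(** Both expected lengths are multiples of E(S h(sqrt F)) with S the residual standard deviation,
    where h is d, resp. the constant t(m). Rotating the errors by an orthogonal matrix that makes X
    triangular turns F and S into functions of U and V, the Euclidean norms of two disjoint groups
    of s and m independent centred normals. The density of such a norm is proportional to
    r^(j-1) exp(-r^2 / (2 sigma^2)); this follows by induction on j from linear substitutions and
    Tonelli only, the constant being recovered from the total mass. The substitution u = l v x in
    the double integral over (u, v), l = sqrt(s/m), then leaves an integral over x = sqrt F whose
    inner v-integral is a Gamma value. As d = t(m) beyond k, subtracting the two cases h = d and
    h = t(m) leaves an integral over [0, k]. *)

Set Implicit Arguments.
Unset Strict Implicit.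

(** * Substitutions and densities *)

(** No density on R^n is ever formed. Independence is kept as a product formula on boxes, and every
    transformation touches one or two coordinates: the orthogonal matrix is a product of plane
    rotations, each preserving the law of the family, and a norm grows by absorbing one coordinate
    at a time. The angular integral arising at each absorption is never evaluated; comparing total
    masses eliminates it. Integrals stay nonnegative and extended-real until the final proof, so
    Tonelli and the substitutions need no integrability. The rotation is adapted to the column space
    of [hypothesis_basis] inside that of X: the first s rotated errors carry F, the last m the
    residual, and the p - s in between enter neither. The weight S in E(S h(sqrt F)) raises the
    exponent of s x^2 + m from (s+m)/2, its value in the density of sqrt F, to (s+m+1)/2. E(W) is
    not evaluated: it contains the same integral as the expected length of I, which is how t(m) E(W)
    comes to stand in the denominator. *)

Section image_measure.
Context d1 d2 (X : measurableType d1) (Y : measurableType d2) (R : realType).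
Variables (phi : X -> Y) (mphi : measurable_fun setT phi).
Variable mu : {measure set X -> \bar R}.

Definition image_measure : {measure set Y -> \bar R}.
Proof. by refine (pushforward mu phi : {measure set Y -> \bar R}). Defined.

Lemma image_measureE A : image_measure A = mu (phi @^-1` A).
Proof. by []. Qed.

Lemma ge0_integral_image (g : Y -> \bar R) :
  measurable_fun setT g -> (forall y, 0 <= g y)%E ->
  (\int[image_measure]_y g y = \int[mu]_x g (phi x))%E.
Proof.
by move=> mg g0; rewrite ge0_integral_pushforward// preimage_setT.
Qed.

End image_measure.

Section affine.
Context {R : realType}.
Local Notation mu := (@lebesgue_measure R).

Lemma measurable_affine (a b : R) :
  measurable_fun setT (fun x : R => a * x + b).
Proof. by apply: measurable_funD => //; apply: measurable_funM. Qed.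

(** [a] times the image of Lebesgue measure under [x |-> a x + b] gives []u, v]] its length, so by
    uniqueness it is Lebesgue measure. Arguing on measures covers every nonnegative measurable [g]
    at once. *)
Lemma integral_affine_pos (a b : R) (g : R -> \bar R) : 0 < a ->
  measurable_fun setT g -> (forall x, 0 <= g x)%E ->
  (\int[mu]_x g x = a%:E * \int[mu]_x g (a * x + b)%R)%E.
Proof.
move=> a0 mg g0.
pose phi := (fun x => a * x + b) : measurableTypeR R -> measurableTypeR R.
have mphi : measurable_fun setT phi by exact: measurable_affine.
pose nu := mscale (NngNum (ltW a0)) (image_measure mphi mu).
have nuE A : measurable A -> mu A = nu A.
  apply: lebesgue_measure_unique => _ [[u v] _ <-] /=.
  rewrite /nu /mscale/= image_measureE.
  have -> : phi @^-1` `]u, v] = `](u - b) / a, (v - b) / a]%classic.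
    apply/seteqP; split=> x /=; rewrite !in_itv/= /phi ltr_pdivrMr// ler_pdivlMr//;
      rewrite ltrBlDr lerBrDr (mulrC x); done.
  suff : mu `]u, v] = mule a%:E (mu `](u - b) / a, (v - b) / a]) by [].
  rewrite !lebesgue_measure_itv/= !lte_fin.
  rewrite ltr_pM2r ?invr_gt0// ltrD2r.
  case: ifPn => uv; last by rewrite mule0.
  rewrite -EFinM; congr EFin; field; exact: lt0r_neq0.
  by [].
transitivity (\int[nu]_x g x)%E.
  by apply: eq_measure_integral => A mA _; exact: nuE.
by rewrite /nu ge0_integral_mscale//= ge0_integral_image.
Qed.

Lemma ge0_integral_opp (g : R -> \bar R) :
  measurable_fun setT g -> (forall x, 0 <= g x)%E ->
  (\int[mu]_x g x = \int[mu]_x g (- x)%R)%E.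
Proof.
move=> mg g0.
have mN : measurable_fun setT (-%R : measurableTypeR R -> measurableTypeR R) by [].
rewrite -(ge0_integral_image mN)//.
by apply: eq_measure_integral => A mA _; exact/esym/lebesgue_measureN.
Qed.

Lemma integral_affine (a b : R) (g : R -> \bar R) : a != 0 ->
  measurable_fun setT g -> (forall x, 0 <= g x)%E ->
  (\int[mu]_x g x = `|a|%:E * \int[mu]_x g (a * x + b)%R)%E.
Proof.
move=> a0 mg g0; have [apos|aneg|/eqP] := ltrgt0P a; last by rewrite (negbTE a0).
- exact: integral_affine_pos.
- rewrite ge0_integral_opp// (@integral_affine_pos (- a) (- b)) ?oppr_gt0//; last first.
    by apply: measurableT_comp.
  by congr (_ * _)%E; apply: eq_integral => x _; congr g; ring.
Qed.

End affine.

(** * Measures with densities and joint laws of pairs *)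

Section density.
Context d (T : measurableType d) (R : realType) (nu : {measure set T -> \bar R}).
Variable f : T -> R.
Hypotheses (mf : measurable_fun setT f) (f0 : forall x, 0 <= f x).
Local Open Scope ereal_scope.

Definition mdensity (A : set T) : \bar R := \int[nu]_(x in A) (f x)%:E.

Let mdensity0 : mdensity set0 = 0. Proof. exact: integral_set0. Qed.

Let mdensity_ge0 A : 0 <= mdensity A.
Proof. by apply: integral_ge0 => x _; rewrite lee_fin. Qed.

Let mdensity_sigma_additive : semi_sigma_additive mdensity.
Proof.
move=> A mA tA mUA; rewrite /mdensity ge0_integral_bigcup//; last 2 first.
- exact/measurable_EFinP/measurable_funTS.
- by move=> x _; rewrite lee_fin.
by apply: is_cvg_ereal_nneg_natsum_cond => n _ _; exact: mdensity_ge0.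
Qed.

HB.instance Definition _ := isMeasure.Build _ _ _
  mdensity mdensity0 mdensity_ge0 mdensity_sigma_additive.

Definition density_measure : {measure set T -> \bar R} := mdensity.

End density.

Import HBNNSimple.

Section joint_density.
Context d (T : measurableType d) (R : realType) (Q : {measure set T -> \bar R}).
Hypothesis Qfin : (Q setT < +oo)%E.
Local Notation mu := (@lebesgue_measure R).
Local Open Scope ereal_scope.

(** By monotone convergence both sides are limits over the same simple approximations of [g]; a
    simple function reduces to indicators, where the claim is the definition of [mdensity]. *)
Lemma ge0_integral_mdensity d' (T' : measurableType d') (nu : {measure set T' -> \bar R})
    (f : T' -> R) (mf : measurable_fun setT f) (f0 : forall x, (0 <= f x)%R)
    (g : T' -> \bar R) : measurable_fun setT g -> (forall x, 0 <= g x) ->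
  \int[density_measure nu mf f0]_x g x = \int[nu]_x (g x * (f x)%:E).
Proof.
move=> mg g0.
pose g_ := nnsfun_approx measurableT mg.
have mm h : measurable_fun setT h -> measurable_fun setT (fun x => h x * (f x)%:E).
  by move=> mh; apply: emeasurable_funM => //; exact/measurable_EFinP.
transitivity (limn (fun n => \int[density_measure nu mf f0]_x (g_ n x)%:E)).
  rewrite -monotone_convergence//.
  - apply: eq_integral => y _; apply/esym/cvg_lim => //.
    by apply: cvg_nnsfun_approx => // *; exact: g0.
  - by move=> n; exact/measurable_EFinP/measurable_funP.
  - by move=> n y _; rewrite lee_fin.
  - by move=> y _ m n mn; rewrite lee_fin; exact/lefP/nd_nnsfun_approx.
transitivity (limn (fun n => \int[nu]_x ((g_ n x)%:E * (f x)%:E))); last first.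
  rewrite -monotone_convergence//.
  - apply: eq_integral => y _; apply/cvg_lim => //.
    apply: cvgeZr => //.
    by apply: cvg_nnsfun_approx => // *; exact: g0.
  - by move=> n; apply: mm; exact/measurable_EFinP/measurable_funP.
  - by move=> n y _; rewrite mule_ge0 ?lee_fin.
  - move=> y _ m n mn; apply: lee_wpmul2r; rewrite lee_fin//.
    exact/lefP/nd_nnsfun_approx.
congr (limn _); apply/funext => n.
under eq_integral do rewrite fimfunE -fsumEFin//.
transitivity (\int[nu]_x (\sum_(y \in range (g_ n))
    (y * \1_(g_ n @^-1` [set y]) x)%:E * (f x)%:E)); last first.
  under [RHS]eq_integral => x _.
    rewrite fimfunE -fsumEFin// ge0_mule_fsuml => [|y]; last exact: nnfun_muleindic_ge0.
    over.
  by [].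
rewrite !ge0_integral_fsum//.
- apply: eq_fsbigr => r rhn.
  rewrite integralZl_indic_nnsfun// integral_indic// setIT.
  under [RHS]eq_integral do rewrite EFinM -muleA.
  rewrite ge0_integralZl//.
  + under [in RHS]eq_integral do rewrite muleC.
    rewrite /= /mdensity [in LHS]integral_mkcond; congr (_ * _).
    by apply: eq_integral => x xE; rewrite epatch_indic.
  + apply: mm; exact/measurable_EFinP.
  + by move=> x _; rewrite mule_ge0 ?lee_fin.
  + by rewrite lee_fin; move: rhn; rewrite inE => -[x _ <-].
- by move=> y; apply: mm; exact/measurable_EFinP/measurable_funM.
- by move=> y x _; apply: mule_ge0; rewrite ?lee_fin//; exact: nnfun_muleindic_ge0.
- by move=> y; exact/measurable_EFinP/measurable_funM.
- by move=> y x _; exact: nnfun_muleindic_ge0.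
Qed.

Lemma integral_indicl d' (T' : measurableType d') (nu : {measure set T' -> \bar R})
    (A : set T') (f : T' -> R) :
  \int[nu]_(x in A) (f x)%:E = \int[nu]_x (\1_A x * f x)%:E.
Proof.
rewrite integral_mkcond; apply: eq_integral => x _.
by rewrite epatch_indic/= -EFinM mulrC.
Qed.

Lemma indicX (T1 T2 : Type) (A : set T1) (B : set T2) (z : T1 * T2) :
  \1_(A `*` B) z = (\1_A z.1 * \1_B z.2)%R :> R.
Proof.
rewrite !indicE -natrM mulnb; congr (_%:R); congr nat_of_bool.
by apply/idP/andP => [|[]]; rewrite !inE.
Qed.

(** Rectangles form a pi-system generating the product sigma-algebra, so the rectangle formula
    determines the image of [Q] under [(U, V)]. [Q] is finite rather than normalised because it will
    be a probability restricted to an event. *)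
Lemma joint_density_integral (U V : T -> R) (f g : R -> R) :
  measurable_fun setT U -> measurable_fun setT V ->
  measurable_fun setT f -> (forall x, 0 <= f x)%R ->
  measurable_fun setT g -> (forall x, 0 <= g x)%R ->
  (forall A B : set R, measurable A -> measurable B ->
    Q (U @^-1` A `&` V @^-1` B) =
    Q setT * (\int[mu]_(x in A) (f x)%:E * \int[mu]_(x in B) (g x)%:E)) ->
  forall h : R * R -> \bar R, measurable_fun setT h -> (forall z, 0 <= h z) ->
  \int[Q]_w h (U w, V w) =
  Q setT * \int[mu]_x \int[mu]_y (h (x, y) * (f x * g y)%:E).
Proof.
move=> mU mV mf f0 mg g0 HQ h mh h0.
have QsetT : Q setT \is a fin_num by rewrite ge0_fin_numE.
pose q : R := fine (Q setT).
have q0 : (0 <= q)%R by rewrite fine_ge0.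
pose phi := (fun w => (U w, V w)) : T -> (measurableTypeR R * measurableTypeR R)%type.
have mphi : measurable_fun setT phi by apply/measurable_fun_pairP; split.
pose F := (fun z => f z.1 * g z.2)%R : measurableTypeR R * measurableTypeR R -> R.
have mF : measurable_fun setT F.
  apply: measurable_funM.
  - exact: (measurableT_comp mf).
  - exact: (measurableT_comp mg).
have F0 z : (0 <= F z)%R by rewrite /F mulr_ge0.
pose nu2 := mscale (NngNum q0) (density_measure (mu \x mu) mF F0).
have mkF (k : R * R -> \bar R) : measurable_fun setT k ->
    measurable_fun setT (fun z => k z * (F z)%:E).
  by move=> mk; apply: emeasurable_funM => //; exact/measurable_EFinP.
have fubF (k : R * R -> \bar R) : measurable_fun setT k -> (forall z, 0 <= k z) ->
   \int[nu2]_z k z = Q setT * \int[mu]_x \int[mu]_y (k (x, y) * (f x * g y)%:E).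
  move=> mk k0.
  rewrite /nu2 ge0_integral_mscale//= /q fineK//; congr (_ * _).
  rewrite ge0_integral_mdensity// fubini_tonelli1//.
  - exact: mkF.
  - by move=> z; rewrite mule_ge0// lee_fin.
have E A : measurable A -> image_measure mphi Q A = nu2 A.
  apply: (measure_unique
    [set C `*` D | C in measurable & D in measurable] (fun=> setT)).
  - exact: measurable_prod_measurableType.
  - move=> _ _ [A1 mA1 [B1 mB1 <-]] [A2 mA2 [B2 mB2 <-]].
    rewrite -setXI; exists (A1 `&` A2); first exact: measurableI.
    by exists (B1 `&` B2) => //; exact: measurableI.
  - by move=> _; exists setT => //; exists setT => //; rewrite setXTT.
  - by rewrite bigcup_const.
  - move=> _ [C mC [D mD <-]].
    rewrite image_measureE.
    have -> : phi @^-1` (C `*` D) = U @^-1` C `&` V @^-1` D by [].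
    have mCD : measurable (C `*` D) by exact: measurableX.
    have mI : measurable_fun setT (fun z : R * R => (\1_(C `*` D) z)%:E : \bar R).
      exact/measurable_EFinP/measurable_indic.
    rewrite HQ// -[X in _ = _ X]setIT -integral_indic// fubF//; congr (_ * _).
    rewrite integral_indicl -ge0_integralZr//.
    - apply: eq_integral => x _.
      rewrite integral_indicl -ge0_integralZl//.
      + apply: eq_integral => y _; rewrite -!EFinM; congr EFin.
        by rewrite indicX/=; ring.
      + by apply/measurable_EFinP/measurable_funM => //; exact: measurable_indic.
      + by move=> y _; rewrite lee_fin mulr_ge0// indicE.
      + by rewrite lee_fin mulr_ge0// indicE.
    - by apply/measurable_EFinP/measurable_funM => //; exact: measurable_indic.
    - by move=> y _; rewrite lee_fin mulr_ge0// indicE.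
    - by apply: integral_ge0 => y _; rewrite lee_fin.
  - by move=> _; rewrite image_measureE preimage_setT.
rewrite -fubF//.
rewrite -(ge0_integral_image mphi)//.
by apply: eq_measure_integral => A mA _; exact: E.
Qed.

End joint_density.

Set Implicit Arguments.
Unset Strict Implicit.


(** * Rotations and radial densities *)

(** Writing the inverse as [x * (x ^+ 2)^-1] moves it to a nonnegative base, where it is a
    measurable real power; at 0 both sides vanish by the convention [0^-1 = 0]. *)
Lemma measurable_invr (R : realType) : measurable_fun setT (fun x : R => x^-1).
Proof.
rewrite (_ : (fun x : R => x^-1) = fun x => x * (x ^+ 2) `^ (-1)).
  apply: measurable_funM => //.
  apply: (measurableT_comp (measurable_powR (-1))).
  exact: measurable_funX.
apply/funext => x; rewrite powR_inv1 ?sqr_ge0//.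
by have [->|x0] := eqVneq x 0; [rewrite invr0 mul0r|field].
Qed.

Section plane.
Context {R : realType}.
Local Notation mu := (@lebesgue_measure R).
Implicit Types (a b c : R) (H : R * R -> \bar R).
Local Open Scope ereal_scope.

Lemma measurable_comp2 H (u v : R * R -> R) :
  measurable_fun setT H -> measurable_fun setT u -> measurable_fun setT v ->
  measurable_fun setT (fun z => H (u z, v z)).
Proof.
move=> mH mu' mv; apply: (measurableT_comp mH).
by apply/measurable_fun_pairP; split.
Qed.

Lemma measurable_secl H a : measurable_fun setT H ->
  measurable_fun setT (fun y => H (a, y)).
Proof. by move=> mH; apply: measurableT_comp. Qed.

Lemma measurable_secr H a : measurable_fun setT H ->
  measurable_fun setT (fun x => H (x, a)).
Proof. by move=> mH; apply: measurableT_comp. Qed.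

Lemma lebesgue_tonelli H : measurable_fun setT H -> (forall z, 0 <= H z) ->
  \int[mu]_x \int[mu]_y H (x, y) = \int[mu]_y \int[mu]_x H (x, y).
Proof. by move=> mH H0; exact: (fubini_tonelli (m1 := mu) (m2 := mu)). Qed.

Lemma measurable_integral_secl H : measurable_fun setT H -> (forall z, 0 <= H z) ->
  measurable_fun setT (fun x => \int[mu]_y H (x, y)).
Proof.
by move=> mH H0; exact: (measurable_fun_fubini_tonelli_F (m2 := mu)).
Qed.

(* Tonelli and one linear substitution in each variable; when [c = 0] the rotation is a swap. *)
Lemma integral_rotation (c s : R) H : (c ^+ 2 + s ^+ 2 = 1)%R ->
  measurable_fun setT H -> (forall z, 0 <= H z) ->
  \int[mu]_x \int[mu]_y H (c * x + s * y, - s * x + c * y)%R =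
  \int[mu]_x \int[mu]_y H (x, y).
Proof.
move=> cs1 mH H0.
have mlin a b : measurable_fun setT (fun z : R * R => a * z.1 + b * z.2)%R.
  by apply: measurable_funD; apply: measurable_funM.
have [c0|c0] := eqVneq c 0%R.
  have s1 : `|s|%R = 1%R.
    by apply/eqP; rewrite -sqrp_eq1// real_normK ?num_real// -cs1 c0 expr0n add0r.
  have s0 : s != 0%R by rewrite -normr_eq0 s1 oner_neq0.
  transitivity (\int[mu]_x \int[mu]_y H (y, - s * x)%R).
    apply: eq_integral => x _.
    rewrite [RHS](@integral_affine _ s 0)//; last first.
      by apply: measurable_secr; exact: mH.
    rewrite s1 mul1e; apply: eq_integral => y _.
    by rewrite c0 !mul0r add0r !addr0.
  rewrite -(lebesgue_tonelli (H := fun z => H (z.1, - s * z.2)%R))//; last first.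
    by apply: measurable_comp2 => //; apply: measurable_funM.
  apply: eq_integral => u _.
  rewrite [RHS](@integral_affine _ (- s) 0) ?oppr_eq0//; last exact: measurable_secl.
  by rewrite normrN s1 mul1e; apply: eq_integral => y _; rewrite addr0.
(* With [u = c x + s y], the identity [c ^+ 2 + s ^+ 2 = 1] turns [- s x + c y] into
   [y / c - (s / c) u]: the rotation factors into two one-variable affine maps, whose Jacobians
   [1 / |c|] and [|c|] cancel. *)
pose H' z := H (z.1, c^-1 * z.2 + - (s / c) * z.1)%R.
have mH' : measurable_fun setT H'.
  apply: measurable_comp2 => //.
  by apply: measurable_funD; apply: measurable_funM.
have H'0 z : 0 <= H' z by exact: H0.
transitivity (\int[mu]_x (`|c^-1|%:E * \int[mu]_y H' (x, y))); last first.
  apply: eq_integral => x _.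
  by rewrite [RHS](@integral_affine _ c^-1 (- (s / c) * x)%R) ?invr_eq0//;
    exact: measurable_secl.
have kc0 : 0 <= `|c^-1|%:E by rewrite lee_fin.
have mF : measurable_fun setT (fun x => \int[mu]_y H' (x, y)).
  exact: measurable_integral_secl.
have mG : measurable_fun setT (fun y => \int[mu]_x H' (x, y)).
  exact: (measurable_fun_fubini_tonelli_G (m1 := mu)).
have F0 x : 0 <= \int[mu]_y H' (x, y) by exact: integral_ge0.
have G0 y : 0 <= \int[mu]_x H' (x, y) by exact: integral_ge0.
rewrite ge0_integralZl// lebesgue_tonelli// -ge0_integralZl//.
rewrite (lebesgue_tonelli (H := fun z => H (c * z.1 + s * z.2, - s * z.1 + c * z.2)%R))//; last first.
  exact: measurable_comp2.
apply: eq_integral => y _.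
rewrite [X in _ * X](@integral_affine _ c (s * y)%R)//; last exact: measurable_secr.
rewrite muleA -EFinM -normrM mulVf// normr1 mul1e.
apply: eq_integral => x _; rewrite /H'/=; congr (H (_, _)).
transitivity (c^-1 * ((c ^+ 2 + s ^+ 2) * y) + - (s / c) * (c * x + s * y))%R.
  by field; exact: c0.
by rewrite cs1 mul1r.
Qed.

End plane.

(** * Radial densities: norms built one coordinate at a time *)

Section radial.
Context {R : realType}.
Local Notation mu := (@lebesgue_measure R).
Variable c : R.
Implicit Types (N : nat) (x y r w : R).

Definition gauss x : R := expR (- (c * x ^+ 2)).

(** For [c = 1 / (2 sigma^2)], the unnormalised density of the norm of [N + 1] independent centred
    normals of variance [sigma^2]. Vanishing on [x <= 0] makes later divisions by the variable
    harmless there. *)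
Definition radial N x : R := \1_`]0, +oo[ x * (x ^+ N * gauss x).

Lemma gauss_ge0 x : 0 <= gauss x. Proof. exact: expR_ge0. Qed.

Lemma measurable_gauss : measurable_fun setT gauss.
Proof.
apply: measurableT_comp => //; apply: measurableT_comp => //.
by apply: measurable_funM => //; apply: measurable_funX.
Qed.

Lemma radialE N x : radial N x = if 0 < x then x ^+ N * gauss x else 0.
Proof.
rewrite /radial indicE mem_setE in_itv/= andbT.
by case: ifP => _; rewrite ?mul1r ?mul0r.
Qed.

Lemma radial_ge0 N x : 0 <= radial N x.
Proof.
by rewrite radialE; case: ifPn => // x0; rewrite mulr_ge0 ?gauss_ge0 ?exprn_ge0 ?ltW.
Qed.

Lemma measurable_radial N : measurable_fun setT (radial N).
Proof.
apply: measurable_funM; first exact: measurable_indic.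
by apply: measurable_funM; [exact: measurable_funX|exact: measurable_gauss].
Qed.


(** The angular factor of polar coordinates, in terms of the slope [y = x / r]. Only its relation to
    the masses, [rmass_rec], will matter. *)
Definition kappa N : \bar R :=
  (\int[mu]_y ((Num.sqrt (1 + y ^+ 2))^-1 ^+ N)%:E)%E.

Lemma measurable_sqrtr1D : measurable_fun setT (fun y : R => Num.sqrt (1 + y ^+ 2)).
Proof.
apply: measurableT_comp => //.
  by apply: continuous_measurable_fun; exact: sqrt_continuous.
by apply: measurable_funD => //; exact: measurable_funX.
Qed.

Lemma sqrtr1D_gt0 (y : R) : 0 < Num.sqrt (1 + y ^+ 2).
Proof. by rewrite sqrtr_gt0 ltr_pwDl ?sqr_ge0. Qed.

(* Substitute [x = r y], exchange, then substitute [w = r sqrt (1 + y^2)]. *)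
Lemma integral_polar N (G : R -> \bar R) :
  measurable_fun setT G -> (forall x, 0 <= G x)%E ->
  (\int[mu]_r \int[mu]_x (G (Num.sqrt (r ^+ 2 + x ^+ 2)) * (radial N r * gauss x)%:E) =
   kappa N.+2 * \int[mu]_w (G w * (radial N.+1 w)%:E))%E.
Proof.
move=> mG G0.
pose s y : R := Num.sqrt (1 + y ^+ 2).
have s0 y : 0 < s y by exact: sqrtr1D_gt0.
(* The integrand after [x = r y]: the Jacobian [r] raises [r ^+ N] to [r ^+ N.+1], and the two
   Gaussians combine since [r^2 + (r y)^2 = (s y * r)^2]. *)
pose H z : \bar R := (G (s z.2 * z.1)%R * ((s z.2)^-1 ^+ N.+1 * radial N.+1 (s z.2 * z.1))%:E)%E.
have H0 z : (0 <= H z)%E.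
  by rewrite mule_ge0// lee_fin mulr_ge0 ?radial_ge0// exprn_ge0// invr_ge0 ltW.
have ms : measurable_fun setT s by exact: measurable_sqrtr1D.
have msi : measurable_fun setT (fun y => (s y)^-1).
  by apply: (measurableT_comp (@measurable_invr R)).
have msz : measurable_fun setT (fun z : R * R => s z.2 * z.1).
  by apply: measurable_funM => //; exact: measurableT_comp.
have mH : measurable_fun setT H.
  apply: emeasurable_funM; first exact: measurableT_comp.
  apply/measurable_EFinP/measurable_funM.
    by apply: measurable_funX; exact: (measurableT_comp msi).
  by apply: measurableT_comp => //; exact: measurable_radial.
transitivity (\int[mu]_r \int[mu]_y H (r, y))%E.
  apply: eq_integral => r _.
  have [r0|r0] := ltP 0 r; last first.
    rewrite !integral0_eq// => x _.
      rewrite /H/= radialE pmulr_rgt0// ltNge r0/= mulr0 mule0//.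
    by rewrite radialE ltNge r0/= mul0r mule0.
  have mGq : measurable_fun setT (fun x : R => G (Num.sqrt (r ^+ 2 + x ^+ 2)) *
      (radial N r * gauss x)%:E)%E.
    apply: emeasurable_funM.
      apply: measurableT_comp => //; apply: measurableT_comp => //.
        by apply: continuous_measurable_fun; exact: sqrt_continuous.
      by apply: measurable_funD => //; exact: measurable_funX.
    by apply/measurable_EFinP/measurable_funM => //; exact: measurable_gauss.
  have Gq0 x : (0 <= G (Num.sqrt (r ^+ 2 + x ^+ 2)) * (radial N r * gauss x)%:E)%E.
    by rewrite mule_ge0// lee_fin mulr_ge0 ?radial_ge0 ?gauss_ge0.
  rewrite [LHS](@integral_affine_pos _ r 0)//.
  have mGs : measurable_fun setT (fun x => G (Num.sqrt (r ^+ 2 + (r * x + 0) ^+ 2)) *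
      (radial N r * gauss (r * x + 0))%:E)%E.
    exact: (measurableT_comp mGq (measurable_affine _ _)).
  rewrite -ge0_integralZl//; last by rewrite lee_fin ltW.
  apply: eq_integral => y _; rewrite addr0 /H/=.
  have -> : Num.sqrt (r ^+ 2 + (r * y) ^+ 2) = s y * r.
    have -> : r ^+ 2 + (r * y) ^+ 2 = r ^+ 2 * (1 + y ^+ 2) by ring.
    by rewrite sqrtrM ?sqr_ge0// sqrtr_sqr gtr0_norm// mulrC.
  rewrite muleCA -EFinM; congr (_ * _%:E)%E.
  rewrite !radialE r0 pmulr_rgt0// r0.
  have -> : gauss (s y * r) = gauss r * gauss (r * y).
    rewrite /gauss -expRD exprMn sqr_sqrtr ?addr_ge0 ?sqr_ge0//; congr expR; ring.
  have -> : (s y)^-1 ^+ N.+1 * ((s y * r) ^+ N.+1 * (gauss r * gauss (r * y))) =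
     ((s y)^-1 * (s y)) ^+ N.+1 * r ^+ N.+1 * (gauss r * gauss (r * y)).
    by rewrite !exprMn; ring.
  rewrite mulVf ?gt_eqF// expr1n exprS; ring.
rewrite lebesgue_tonelli//.
have mGr : measurable_fun setT (fun w => G w * (radial N.+1 w)%:E)%E.
  by apply: emeasurable_funM => //; apply/measurable_EFinP; exact: measurable_radial.
have Gr0 w : (0 <= G w * (radial N.+1 w)%:E)%E.
  by rewrite mule_ge0// lee_fin radial_ge0.
have mk : measurable_fun setT (fun y => ((s y)^-1 ^+ N.+2)%:E).
  by apply/measurable_EFinP; apply: measurable_funX.
have k0 y : (0 <= ((s y)^-1 ^+ N.+2)%:E)%E.
  by rewrite lee_fin exprn_ge0// invr_ge0 ltW.
have I0 : (0 <= \int[mu]_w (G w * (radial N.+1 w)%:E))%E by exact: integral_ge0.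
rewrite -ge0_integralZr//.
apply: eq_integral => y _.
rewrite [in RHS](@integral_affine_pos _ (s y) 0)//.
(* Of the [N + 2] factors [1 / s y], one cancels the Jacobian of [w = s y * r]; the others already
   belong to [H]. *)
rewrite exprS mulrC EFinM -muleA (muleA (s y)^-1%:E) -EFinM mulVf ?gt_eqF// mul1e.
have mGs : measurable_fun setT (fun x => G (s y * x + 0)%R * (radial N.+1 (s y * x + 0))%:E)%E.
  by apply: (measurableT_comp mGr); apply: measurable_affine.
have k1 : (0 <= ((s y)^-1 ^+ N.+1)%:E)%E by rewrite lee_fin exprn_ge0// invr_ge0 ltW.
rewrite -ge0_integralZl//.
by apply: eq_integral => r _; rewrite /H/= addr0 EFinM muleCA.
Qed.


Lemma integral_even (G : R -> \bar R) :
  measurable_fun setT G -> (forall x, 0 <= G x)%E ->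
  (\int[mu]_x (G `|x|%R * (gauss x)%:E) = 2%:E * \int[mu]_w (G w * (radial 0 w)%:E))%E.
Proof.
move=> mG G0.
have mr : measurable_fun setT (fun w => G w * (radial 0 w)%:E)%E.
  by apply: emeasurable_funM => //; apply/measurable_EFinP; exact: measurable_radial.
have r0 w : (0 <= G w * (radial 0 w)%:E)%E by rewrite mule_ge0// lee_fin radial_ge0.
have mrN : measurable_fun setT (fun w => G (- w)%R * (radial 0 (- w))%:E)%E.
  exact: (measurableT_comp mr).
have mg : measurable_fun setT (fun x => G `|x|%R * (gauss x)%:E)%E.
  apply: emeasurable_funM; first by apply: (measurableT_comp mG); exact: normr_measurable.
  by apply/measurable_EFinP; exact: measurable_gauss.
have rN0 w : (0 <= G (- w)%R * (radial 0 (- w))%:E)%E by exact: r0.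
have mD : measurable ([set: R] `\ (0 : R)) by exact: measurableD.
(* At 0 both one-sided integrands vanish while the original one need not, so this null point is
   removed before splitting. *)
rewrite -(@integral_setD1 _ _ 0)//; last exact: measurable_funTS.
transitivity (\int[mu]_(x in setT `\ 0%R)
  (G x * (radial 0 x)%:E + G (- x)%R * (radial 0 (- x))%:E))%E.
  apply: eq_integral => x; rewrite inE/= => -[_ /eqP x0].
  have gN : gauss (- x) = gauss x by rewrite /gauss sqrrN.
  rewrite !radialE !expr0 !mul1r gN oppr_gt0.
  have [xp|xn|/eqP] := ltrgt0P x; last by rewrite (negbTE x0).
  - by rewrite mule0 adde0.
  - by rewrite mule0 add0e.
rewrite integral_setD1//; last by apply: measurable_funTS; exact: emeasurable_funD.
rewrite ge0_integralD//.
rewrite -(@ge0_integral_opp _ (fun x => G x * (radial 0 x)%:E)%E)//.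
have -> : (2 : R)%:E = (1 + 1)%E by rewrite -EFinD.
by rewrite ge0_muleDl ?lee01// !mul1e.
Qed.

Variable g : R.
Hypotheses (g0 : 0 < g) (gE : (\int[mu]_x (gauss x)%:E = g%:E)%E).

Lemma kappa_ge0 N : (0 <= kappa N)%E.
Proof.
apply: integral_ge0 => y _; rewrite lee_fin exprn_ge0// invr_ge0 sqrtr_ge0.
Qed.

(** The case [G = 1] of [integral_polar], whose left side factors into the mass of [radial N] and
    the Gaussian mass [g]. *)
Lemma radial_mass_rec N :
  ((\int[mu]_x (radial N x)%:E) * g%:E = kappa N.+2 * \int[mu]_x (radial N.+1 x)%:E)%E.
Proof.
have := @integral_polar N (fun=> 1%E) (measurable_cst _) (fun=> lee01).
under eq_integral => r _.
  under eq_integral do rewrite mul1e EFinM.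
  rewrite ge0_integralZl//; last 3 first.
  - by apply/measurable_EFinP; exact: measurable_gauss.
  - by move=> x _; rewrite lee_fin gauss_ge0.
  - by rewrite lee_fin radial_ge0.
  rewrite gE.
  over.
rewrite ge0_integralZr//; last 3 first.
- by apply/measurable_EFinP; exact: measurable_radial.
- by move=> x _; rewrite lee_fin radial_ge0.
- by rewrite lee_fin ltW.
by under [in RHS]eq_integral do rewrite mul1e.
Qed.

(* [kappa] and [radial_mass_rec] propagate finiteness of the mass from the Gaussian integral. *)
Lemma radial_mass N : exists2 M : R, 0 < M & (\int[mu]_x (radial N x)%:E = M%:E)%E.
Proof.
have I0 n : (0 <= \int[mu]_x (radial n x)%:E)%E.
  by apply: integral_ge0 => x _; rewrite lee_fin radial_ge0.
elim: N => [|N [M M0 ME]].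
  have := @integral_even (fun=> 1%E) (measurable_cst _) (fun=> lee01).
  under eq_integral do rewrite mul1e.
  under [in RHS]eq_integral do rewrite mul1e.
  rewrite gE; move: (I0 0%N); case: (\int[mu]_x (radial 0 x)%:E)%E => [r| |]//.
  - move=> _ [gr]; exists r => //.
    by move: g0; rewrite gr pmulr_rgt0.
  - by rewrite mulry gtr0_sg// mul1e.
have := radial_mass_rec N.
rewrite ME -EFinM => /esym.
have Mg : 0 < M * g by exact: mulr_gt0.
(* Nonnegative extended reals whose product is the positive real [M * g] are neither zero nor
   infinite, given that [0 * +oo = 0]. *)
move: (I0 N.+1) (kappa_ge0 N.+2).
case: (\int[mu]_x (radial N.+1 x)%:E)%E => [r| |]//; case: (kappa N.+2) => [k| |]//.
- rewrite !lee_fin => r0 k0 [/esym E]; exists r => //.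
  rewrite lt_neqAle r0 andbT; apply/eqP => r00; move: Mg.
  by rewrite E -r00 mulr0 ltxx.
- rewrite lee_fin le_eqVlt => /predU1P[<-|r0] _.
    by rewrite mule0 => -[/esym E]; rewrite E ltxx in Mg.
  by rewrite mulyr gtr0_sg// mul1e.
- move=> _; rewrite lee_fin le_eqVlt => /predU1P[<-|k0].
    by rewrite mul0e => -[/esym E]; rewrite E ltxx in Mg.
  by rewrite mulry gtr0_sg// mul1e.
Qed.

Definition rmass N : R := fine (\int[mu]_x (radial N x)%:E)%E.

Lemma rmass_gt0 N : 0 < rmass N.
Proof. by have [M M0 ME] := radial_mass N; rewrite /rmass ME. Qed.

Lemma rmassE N : (\int[mu]_x (radial N x)%:E = (rmass N)%:E)%E.
Proof. by have [M M0 ME] := radial_mass N; rewrite /rmass ME. Qed.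

Definition rpdf N x : R := radial N x / rmass N.

Lemma rpdf_ge0 N x : 0 <= rpdf N x.
Proof. by rewrite divr_ge0 ?radial_ge0 ?ltW ?rmass_gt0. Qed.

Lemma measurable_rpdf N : measurable_fun setT (rpdf N).
Proof. by apply: measurable_funM => //; exact: measurable_radial. Qed.

Lemma rmass_rec N : ((rmass N * g)%:E = kappa N.+2 * (rmass N.+1)%:E)%E.
Proof. by rewrite EFinM -!rmassE radial_mass_rec. Qed.

(** The inductive step for norms: adjoining one normal coordinate to a norm with density [rpdf N]
    yields density [rpdf N.+1]. The constant [kappa N.+2 / (rmass N * g)] is [1 / rmass N.+1] by
    [rmass_rec]. *)
Lemma integral_rpdf_polar N (G : R -> \bar R) :
  measurable_fun setT G -> (forall x, 0 <= G x)%E ->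
  (\int[mu]_r \int[mu]_x (G (Num.sqrt (r ^+ 2 + x ^+ 2)) * (rpdf N r * (gauss x / g))%:E) =
   \int[mu]_w (G w * (rpdf N.+1 w)%:E))%E.
Proof.
move=> mG G0.
pose H z := (G (Num.sqrt (z.1 ^+ 2 + z.2 ^+ 2)) * (radial N z.1 * gauss z.2)%:E)%E.
have H0 z : (0 <= H z)%E by rewrite mule_ge0// lee_fin mulr_ge0 ?radial_ge0 ?gauss_ge0.
have mH : measurable_fun setT H.
  apply: emeasurable_funM.
    apply: (measurableT_comp mG); apply: measurableT_comp => //.
      by apply: continuous_measurable_fun; exact: sqrt_continuous.
    by apply: measurable_funD; apply: measurable_funX.
  apply/measurable_EFinP; apply: measurable_funM.
    by apply: measurableT_comp => //; exact: measurable_radial.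
  by apply: measurableT_comp => //; exact: measurable_gauss.
have M0 := rmass_gt0 N.
have k0 : (0 <= ((rmass N * g)^-1)%:E)%E by rewrite lee_fin invr_ge0 mulr_ge0 ?ltW.
transitivity (\int[mu]_r (((rmass N * g)^-1)%:E * \int[mu]_x H (r, x)))%E.
  apply: eq_integral => r _.
  rewrite -ge0_integralZl//; last exact: measurable_secl.
  apply: eq_integral => x _; rewrite /H/= muleCA -EFinM; congr (_ * _%:E)%E.
  by rewrite /rpdf; field; rewrite !gt_eqF.
have mFH : measurable_fun setT (fun r => \int[mu]_x H (r, x))%E.
  exact: measurable_integral_secl.
have FH0 r : (0 <= \int[mu]_x H (r, x))%E by exact: integral_ge0.
rewrite ge0_integralZl//.
rewrite integral_polar// muleA.
have mGr : measurable_fun setT (fun w => G w * (radial N.+1 w)%:E)%E.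
  by apply: emeasurable_funM => //; apply/measurable_EFinP; exact: measurable_radial.
have Gr0 w : (0 <= G w * (radial N.+1 w)%:E)%E by rewrite mule_ge0// lee_fin radial_ge0.
have M1 := rmass_gt0 N.+1.
have k1 : (0 <= ((rmass N.+1)^-1)%:E)%E by rewrite lee_fin invr_ge0 ltW.
have -> : (((rmass N * g)^-1)%:E * kappa N.+2 = ((rmass N.+1)^-1)%:E)%E.
  have := rmass_rec N; move: (kappa N.+2) => [k| |].
  - move=> [E]; rewrite -EFinM; congr EFin.
    have kM : 0 < k * rmass N.+1 by rewrite -E mulr_gt0.
    have k0' : 0 < k by rewrite -(pmulr_lgt0 _ M1).
    by rewrite E; field; rewrite !gt_eqF.
  - by rewrite mulyr gtr0_sg// mul1e.
  - by rewrite mulNyr gtr0_sg// mul1e.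
rewrite -ge0_integralZl//.
by apply: eq_integral => x _; rewrite muleCA -EFinM (mulrC (_^-1)).
Qed.

(** The base case: the norm of a single coordinate is its absolute value, and the two half-lines
    give [g = 2 * rmass 0]. *)
Lemma integral_rpdf0_abs (G : R -> \bar R) :
  measurable_fun setT G -> (forall x, 0 <= G x)%E ->
  (\int[mu]_x (G `|x|%R * (gauss x / g)%:E) = \int[mu]_w (G w * (rpdf 0 w)%:E))%E.
Proof.
move=> mG G0.
have M0 := rmass_gt0 0%N.
have gM : g = 2 * rmass 0.
  have := integral_even (measurable_cst (1%E : \bar R)) (fun=> lee01).
  under eq_integral do rewrite mul1e.
  under [in RHS]eq_integral do rewrite mul1e.
  by rewrite gE rmassE => -[].
have mGr : measurable_fun setT (fun w => G w * (radial 0 w)%:E)%E.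
  by apply: emeasurable_funM => //; apply/measurable_EFinP; exact: measurable_radial.
have Gr0 w : (0 <= G w * (radial 0 w)%:E)%E by rewrite mule_ge0// lee_fin radial_ge0.
have mGg : measurable_fun setT (fun x => G `|x|%R * (gauss x)%:E)%E.
  apply: emeasurable_funM; first by apply: (measurableT_comp mG); exact: normr_measurable.
  by apply/measurable_EFinP; exact: measurable_gauss.
have Gg0 x : (0 <= G `|x|%R * (gauss x)%:E)%E by rewrite mule_ge0// lee_fin gauss_ge0.
have k0 : (0 <= (g^-1)%:E)%E by rewrite lee_fin invr_ge0 ltW.
have k1 : (0 <= ((rmass 0)^-1)%:E)%E by rewrite lee_fin invr_ge0 ltW.
transitivity ((g^-1)%:E * \int[mu]_x (G `|x|%R * (gauss x)%:E))%E.
  by rewrite -ge0_integralZl//; apply: eq_integral => x _; rewrite muleCA -EFinM (mulrC g^-1).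
rewrite integral_even// muleA -EFinM.
have -> : g^-1 * 2 = (rmass 0)^-1 by rewrite gM; field; rewrite gt_eqF.
by rewrite -ge0_integralZl//; apply: eq_integral => x _; rewrite muleCA -EFinM (mulrC (_^-1)).
Qed.

End radial.

Set Implicit Arguments.
Unset Strict Implicit.


(** * Radial masses and the Gamma function *)

Section Gamma.
Context {R : realType}.
Local Notation mu := (@lebesgue_measure R).

Lemma cvg_integral_0y (lo hi : nat -> R) (f : R -> \bar R) :
  (forall n, 0 < lo n) -> nonincreasing_seq lo -> nondecreasing_seq hi ->
  (forall x, 0 < x -> exists n, lo n <= x <= hi n) ->
  measurable_fun (`]0, +oo[%classic : set R) f -> (forall x, 0 < x -> (0 <= f x)%E) ->
  (\int[mu]_(x in `[lo n, hi n]) f x)%E @[n --> \oo] --> (\int[mu]_(x in `]0%R, +oo[) f x)%E.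
Proof.
move=> e0 ndec nhi esmall mf f0.
have E : `]0, +oo[%classic = \bigcup_n `[lo n, hi n]%classic :> set R.
  apply/seteqP; split => x /=.
    rewrite in_itv/= andbT => x0; have [n nx] := esmall _ x0.
    by exists n => //=; rewrite in_itv/= nx.
  by move=> [n _] /=; rewrite !in_itv/= !andbT => /andP[+ _]; exact: lt_le_trans.
rewrite E; apply: ge0_nondecreasing_set_cvg_integral => //.
- apply/nondecreasing_seqP => n; rewrite subsetEset => x /=.
  rewrite !in_itv/= => /andP[h1 h2]; apply/andP; split.
    by apply: le_trans h1; exact: ndec.
  by apply: le_trans h2 _; exact: nhi.
- move=> n; apply: measurable_funS mf => // x /=; rewrite !in_itv/= !andbT => /andP[+ _].
  exact: lt_le_trans.
- by move=> n x /=; rewrite in_itv/= => /andP[nx _]; apply: f0; exact: lt_le_trans nx.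
Qed.

Lemma continuous_powR (y x : R) : 0 < x -> {for x, continuous (fun t : R => t `^ y)}.
Proof.
move=> x0; apply: differentiable_continuous; apply/derivable1_diffP.
by apply: derivable_powR; rewrite in_itv/= x0.
Qed.

(** Restricted to compact intervals away from 0 because the Gamma integrand [t^(x-1) exp(-t)] is
    singular at 0 when [x < 1]; [cvg_integral_0y] then recovers the half-line. *)
Lemma integral_sqr_substitution (c a b : R) (f : R -> R) : 0 < c -> 0 < a -> a <= b ->
  (forall x, 0 < x -> {for x, continuous f}) ->
  (\int[mu]_(t in `[(c * a ^+ 2)%R, (c * b ^+ 2)%R]) (f t)%:E =
   \int[mu]_(r in `[a, b]) (f (c * r ^+ 2) * (2 * c * r))%:E)%E.
Proof.
move=> c0 a0 ab cf.
pose F (r : R) : R := c * r ^+ 2.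
have dF (r : R) : is_derive r 1 F (2 * c * r).
  rewrite /F; apply: is_derive_eq; rewrite /GRing.scale/=; ring.
have F'E : (F^`())%classic = fun r => 2 * c * r.
  by apply/funext => r; rewrite derive1E; apply: derive_val.
have cF' : continuous (F^`())%classic.
  by rewrite F'E => r; apply: cvgM => //; exact: cvg_cst.
have cF : continuous F.
  by move=> r; apply: cvgM; [exact: cvg_cst|exact: sqr_continuous].
rewrite -[(c * a ^+ 2)%R]/(F a) -[(c * b ^+ 2)%R]/(F b).
rewrite (@integration_by_substitution_increasing _ F)//.
- by apply: eq_integral => r _; rewrite F'E.
- move=> x y; rewrite !in_itv/= => /andP[ax xb] /andP[ay yb] xy; rewrite /F ltr_pM2l//.
  have [x0 y0] : 0 <= x /\ 0 <= y by split; lra.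
  by rewrite ltr_pXn2r ?nnegrE.
- apply/cvg_ex; exists (F^`() a)%classic.
  by apply: cvg_at_right_filter; exact: cF'.
- apply/cvg_ex; exists (F^`() b)%classic.
  by apply: cvg_at_left_filter; exact: cF'.
- split.
  + by move=> x _; exact: ex_derive.
  + by apply: cvg_at_right_filter; exact: cF.
  + by apply: cvg_at_left_filter; exact: cF.
- apply: continuous_in_subspaceT => x; rewrite inE/= in_itv/= => /andP[Fx _].
  by apply: cf; apply: lt_le_trans Fx; rewrite /F mulr_gt0 ?exprn_gt0.
Qed.

(** With [x = (N+1)/2], the substitution [t = c r^2] turns [t^(x-1) exp(-t) dt] into
    [2 c^x r^N exp(-c r^2) dr], as [2 x - 1 = N]. It is made for [r] in [[1/(n+1), n+1]] and passed
    to the limit. *)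
Lemma rmass_Gamma (c : R) N : 0 < c ->
  rmass c N = 2^-1 * c `^ (- (N.+1%:R / 2)) * Gamma (N.+1%:R / 2).
Proof.
move=> c0.
pose x : R := N.+1%:R / 2.
pose f (t : R) := t `^ (x - 1) * expR (- t).
have f0 t : 0 < t -> 0 <= f t by move=> _; rewrite mulr_ge0 ?powR_ge0 ?expR_ge0.
have cf t : 0 < t -> {for t, continuous f}.
  move=> t0; apply: cvgM; first exact: continuous_powR.
  by apply: continuous_comp; [exact: continuousN|exact: continuous_expR].
have mf : measurable_fun setT f.
  apply: measurable_funM; first exact: measurable_powR.
  by apply: measurableT_comp => //; exact: measurable_funN.
pose e (n : nat) : R := n.+1%:R^-1.
have e0 n : 0 < e n by rewrite /e.
have e0' n : 0 <= e n by exact: ltW.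
have ne : nonincreasing_seq e by move=> m n mn; rewrite /e lef_pV2 ?posrE// ler_nat.
have nei : nondecreasing_seq (fun n => (e n)^-1).
  by move=> m n mn; rewrite /e !invrK ler_nat.
have es t : 0 < t -> exists n, e n <= t <= (e n)^-1.
  move=> t0; exists (Num.truncn (Num.max t t^-1)).
  have := truncnS_gt (Num.max t t^-1); rewrite gt_max => /andP[h1 h2].
  rewrite /e invrK (ltW h1) andbT -[leRHS]invrK lef_pV2 ?posrE ?invr_gt0//.
  exact: ltW.
have ein n : e n <= (e n)^-1.
  rewrite /e invrK (@le_trans _ _ 1)// ?ler1n//.
  by rewrite invf_le1// ler1n.
pose h (r : R) := f (c * r ^+ 2) * (2 * c * r).
have hE r : 0 < r -> h r = 2 * c `^ x * (r ^+ N * gauss c r).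
  move=> r0; rewrite /h /f /gauss powRM ?sqr_ge0 ?ltW// -powR_mulrn ?ltW//.
  rewrite -powRrM (_ : 2%:R * (x - 1) = N%:R - 1); last first.
    by rewrite /x -natr1; field.
  rewrite !powRB ?(gt_eqF c0) ?(gt_eqF r0) ?implybT// !powRr1 ?ltW// !powR_mulrn ?ltW//.
  by field; rewrite !gt_eqF.
have h0 r : 0 < r -> 0 <= h r.
  by move=> r0; rewrite hE// !mulr_ge0 ?powR_ge0 ?gauss_ge0 ?exprn_ge0 ?ltW.
have L1 : (\int[mu]_(t in `[(c * e n ^+ 2)%R, (c * (e n)^-1 ^+ 2)%R]) (f t)%:E)%E @[n --> \oo] -->
    (\int[mu]_(t in `]0%R, +oo[) (f t)%:E)%E.
  apply: (@cvg_integral_0y (fun n => c * e n ^+ 2) (fun n => c * (e n)^-1 ^+ 2)).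
  - by move=> n; rewrite mulr_gt0 ?exprn_gt0.
  - move=> m n mn; rewrite ler_pM2l// ler_pXn2r ?nnegrE//; exact: ne.
  - move=> m n mn; rewrite ler_pM2l// ler_pXn2r ?nnegrE ?invr_ge0//; exact: nei.
  - move=> t t0; have tc := divr_gt0 t0 c0.
    have q0 : 0 < Num.sqrt (t / c) by rewrite sqrtr_gt0.
    have [n /andP[n1 n2]] := es _ q0.
    have -> : t = c * Num.sqrt (t / c) ^+ 2.
      by rewrite sqr_sqrtr ?ltW//; field; rewrite gt_eqF.
    by exists n; rewrite !ler_pM2l// !ler_pXn2r ?nnegrE ?invr_ge0 ?(ltW q0)// n1.
  - by apply/measurable_EFinP; exact: measurable_funTS.
  - by move=> t t0; rewrite lee_fin f0.
have mh : measurable_fun (`]0, +oo[%classic : set R) h.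
  apply: measurable_funTS; apply: measurable_funM; last exact: measurable_funM.
  by apply: (measurableT_comp mf); apply: measurable_funM => //; exact: measurable_funX.
have L2 : (\int[mu]_(r in `[(e n : R), ((e n)^-1)%R]) (h r)%:E)%E @[n --> \oo] -->
    (\int[mu]_(r in `]0%R, +oo[) (h r)%:E)%E.
  by apply: cvg_integral_0y => //; exact/measurable_EFinP.
have {L1 L2} E : (\int[mu]_(t in `]0%R, +oo[) (f t)%:E =
    \int[mu]_(r in `]0%R, +oo[) (h r)%:E)%E.
  apply: cvg_unique L1 _; first exact: ereal_hausdorff.
  rewrite /= (_ : (fun n => \int[mu]_(t in `[(c * e n ^+ 2)%R, (c * (e n)^-1 ^+ 2)%R]) (f t)%:E)%E = fun n => \int[mu]_(r in `[(e n : R), ((e n)^-1)%R]) (h r)%:E)%E//.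
  by apply/funext => n; rewrite (integral_sqr_substitution c0).
have Er : (\int[mu]_(r in `]0%R, +oo[) (h r)%:E = (2 * c `^ x)%:E * \int[mu]_r (radial c N r)%:E)%E.
  rewrite -ge0_integralZl//; last 3 first.
  - by apply/measurable_EFinP; exact: measurable_radial.
  - by move=> r _; rewrite lee_fin radial_ge0.
  - by rewrite lee_fin mulr_ge0// powR_ge0.
  rewrite integral_indicl; apply: eq_integral => r _.
  rewrite -EFinM /radial; congr EFin.
  have [r0|r0] := ltP 0 r; last first.
    by rewrite indicE mem_setE in_itv/= ltNge r0/= !mul0r mulr0.
  by rewrite hE//; ring.
have -> : Gamma (N.+1%:R / 2) = 2 * c `^ x * rmass c N.
  rewrite /Gamma /Rintegral E Er /rmass.
  (* Finiteness is not assumed: [fine] reads a divergent integral as 0 on both sides. *)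
  have [->|[->|rfin]] : (\int[mu]_r (radial c N r)%:E = 0 \/
      \int[mu]_r (radial c N r)%:E = +oo \/ \int[mu]_r (radial c N r)%:E \is a fin_num)%E.
  - have : (0 <= \int[mu]_r (radial c N r)%:E)%E.
      by apply: integral_ge0 => r _; rewrite lee_fin radial_ge0.
    by case: (\int[mu]_r (radial c N r)%:E)%E => [r| |]// _; [right;right|right;left].
  - by rewrite mule0 mulr0.
  - by rewrite mulry gtr0_sg ?mul1e ?mulr0// mulr_gt0 ?powR_gt0.
  - by rewrite fineM.
by rewrite -/x powRN; field; rewrite gt_eqF// powR_gt0.
Qed.

End Gamma.

(** * Givens rotations *)

Section givens.
Context {R : rcfType}.

Definition givens {n} (i j : 'I_n) (c s : R) : 'M[R]_n :=
  \matrix_(k, l) if k == i then c * (l == i)%:R + s * (l == j)%:R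
                 else if k == j then - s * (l == i)%:R + c * (l == j)%:R
                 else (k == l)%:R.

Lemma givens_mulE n q (i j : 'I_n) (c s : R) (M : 'M[R]_(n, q)) k l : i != j ->
  (givens i j c s *m M) k l =
    if k == i then c * M i l + s * M j l
    else if k == j then - s * M i l + c * M j l else M k l.
Proof.
move=> ij; rewrite mxE.
have delta (h : 'I_n) (f : 'I_n -> R) : \sum_u (u == h)%:R * f u = f h.
  rewrite (bigD1 h)//= eqxx mul1r big1 ?addr0// => u /negbTE->; exact: mul0r.
have lin (a b : R) : \sum_u (a * (u == i)%:R + b * (u == j)%:R) * M u l =
    a * M i l + b * M j l.
  under eq_bigr do rewrite mulrDl -!mulrA.
  by rewrite big_split/= -!mulr_sumr !delta.
case: ifP => ki; [|case: ifP => kj].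
- by rewrite -lin; apply: eq_bigr => u _; rewrite mxE ki.
- by rewrite -lin; apply: eq_bigr => u _; rewrite mxE ki kj.
- by rewrite -[RHS](delta k (M ^~ l)); apply: eq_bigr => u _; rewrite mxE ki kj eq_sym.
Qed.

Lemma trmx_givens n (i j : 'I_n) (c s : R) : i != j ->
  (givens i j c s)^T = givens i j c (- s).
Proof.
move=> ij; apply/matrixP => k l; rewrite !mxE.
case: (eqVneq k i) => [->|ki]; case: (eqVneq l i) => [->|li];
  rewrite ?eqxx ?(negbTE ij) ?(negbTE ki) ?(negbTE li) //.
- by rewrite /=; ring.
- by case: (eqVneq l j) => [_|/negbTE lj]; rewrite ?eqxx ?lj /=; ring.
- by case: (eqVneq k j) => [_|/negbTE kj]; rewrite ?eqxx ?kj /=; ring.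
- case: (eqVneq l j) => lj; case: (eqVneq k j) => kj /=.
  + ring.
  + by rewrite lj (negbTE kj)/=; ring.
  + by rewrite kj (negbTE lj)/=; ring.
  + by rewrite eq_sym.
Qed.

Lemma givens_orthogonal n (i j : 'I_n) (c s : R) : i != j -> c ^+ 2 + s ^+ 2 = 1 ->
  (givens i j c s)^T *m givens i j c s = 1%:M.
Proof.
move=> ij cs1; have ji : j != i by rewrite eq_sym.
rewrite trmx_givens//; apply/matrixP => k l; rewrite givens_mulE// !mxE !eqxx (negbTE ji).
case: (eqVneq k i) => [->|ki]; [|case: (eqVneq k j) => [->|kj]] => //.
- rewrite -[RHS]mul1r -cs1 [i == l]eq_sym; ring.
- rewrite -[RHS]mul1r -cs1 [j == l]eq_sym; ring.
Qed.

(** The invariant [Q] lets any property stable under plane rotations, here the law of the rotated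
    errors, travel along the elimination instead of being proved afterwards for a general orthogonal
    matrix. *)
Lemma givens_triangularization n p (Q : 'M[R]_n -> Prop) (M : 'M[R]_(n, p)) :
  Q 1%:M ->
  (forall (i j : 'I_n) (c s : R) W, i != j -> c ^+ 2 + s ^+ 2 = 1 -> Q W ->
    Q (givens i j c s *m W)) ->
  exists2 W, Q W & forall (i : 'I_n) (j : 'I_p), (j < i)%N -> (W *m M) i j = 0.
Proof.
move=> Q1 QG.
suff main k : exists2 W, Q W &
    forall (i : 'I_n) (j : 'I_p), (j < i)%N -> (j < k)%N -> (W *m M) i j = 0.
  by have [W QW WM] := main p; exists W => // i j ji; apply: WM.
elim: k => [|k [W QW WM]]; first by exists 1%:M.
have [kp|pk] := ltnP k p; last first.
  by exists W => // i j ji _; apply: WM => //; exact: leq_trans (ltn_ord j) pk.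
have [kn|nk] := ltnP k n; last first.
  exists W => // i j ji; rewrite ltnS leq_eqVlt => /predU1P[jk|]; last exact: WM.
  by have := leq_trans ji (ltnW (leq_trans (ltn_ord i) nk)); rewrite jk ltnn.
pose k0 : 'I_n := Ordinal kn; pose l0 : 'I_p := Ordinal kp.
(* Columns before [k] are already cleared; the inner induction on [r] clears column [k] below the
   diagonal row by row. *)
suff /(_ n) [W' [QW' WM' Wk]] : forall r, exists W', [/\ Q W',
    forall (i : 'I_n) (j : 'I_p), (j < i)%N -> (j < k)%N -> (W' *m M) i j = 0 &
    forall i : 'I_n, (k < i)%N -> (i < r)%N -> (W' *m M) i l0 = 0].
  exists W' => // i j ji; rewrite ltnS leq_eqVlt => /predU1P[jk|]; last exact: WM'.
  by rewrite (_ : j = l0); [apply: Wk; rewrite // -jk|exact: val_inj].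
elim=> [|r [W' [QW' WM' Wk]]]; first by exists W; split.
have [/andP[kr rn]|/negP krn] := boolP ((k < r) && (r < n))%N; last first.
  exists W'; split => // i ki; rewrite ltnS leq_eqVlt => /predU1P[ir|]; last exact: Wk.
  by case: krn; rewrite -ir ki ltn_ord.
pose r0 : 'I_n := Ordinal rn.
pose u := (W' *m M) k0 l0; pose v := (W' *m M) r0 l0.
have kr0 : k0 != r0 by rewrite -val_eqE/= ltn_eqF.
have [v0|v0] := eqVneq v 0.
  exists W'; split => // i ki; rewrite ltnS leq_eqVlt => /predU1P[ir|]; last exact: Wk.
  by rewrite (_ : i = r0)//; exact: val_inj.
pose rho := Num.sqrt (u ^+ 2 + v ^+ 2).
have uv0 : 0 < u ^+ 2 + v ^+ 2 by rewrite ltr_wpDl ?sqr_ge0// exprn_even_gt0.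
have rho0 : rho != 0 by rewrite gt_eqF// sqrtr_gt0.
have rho2 : rho ^+ 2 = u ^+ 2 + v ^+ 2 by rewrite sqr_sqrtr// ltW.
have cs1 : (u / rho) ^+ 2 + (v / rho) ^+ 2 = 1.
  by rewrite !expr_div_n -mulrDl -rho2 divff// expf_neq0.
(* This rotation sends the pair [(u, v)] in rows [k0], [r0] of column [k] to [(rho, 0)]. Cleared
   columns survive because both rows are zero there. *)
exists (givens k0 r0 (u / rho) (v / rho) *m W'); split; first exact: QG.
- move=> i j ji jk; rewrite -mulmxA givens_mulE//.
  have e1 : (W' *m M) k0 j = 0 by exact: WM'.
  have e2 : (W' *m M) r0 j = 0 by apply: WM' => //; exact: ltn_trans kr.
  by rewrite e1 e2 !mulr0 addr0 WM' // !if_same.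
- move=> i ki; rewrite ltnS leq_eqVlt -mulmxA givens_mulE// => /predU1P[ir|ir].
    have -> : i = r0 by exact: val_inj.
    by rewrite eq_sym (negbTE kr0) eqxx -/u -/v; field.
  have ik : (i == k0) = false by rewrite -val_eqE/= gtn_eqF.
  have irr : (i == r0) = false by rewrite -val_eqE/= ltn_eqF.
  by rewrite ik irr Wk.
Qed.

End givens.

(** * Gram matrices and orthogonal projections *)

Section gram.
Context {R : rcfType}.

Lemma sqnorm_eq0 n (v : 'cV[R]_n) : (v^T *m v) 0 0 = 0 -> v = 0.
Proof.
rewrite mxE => /eqP; rewrite psumr_eq0; last by move=> i _; rewrite mxE -expr2 sqr_ge0.
move=> /allP h; apply/matrixP => i j; rewrite ord1 mxE.
have := h i (mem_index_enum i); rewrite /= mxE -expr2 sqrf_eq0; exact/eqP.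
Qed.

Lemma gram_unitmx n p (M : 'M[R]_(n, p)) : \rank M = p -> M^T *m M \in unitmx.
Proof.
move=> rM; rewrite -row_free_unit; apply/inj_row_free => v vM.
have M0 : M *m v^T = 0.
  apply: sqnorm_eq0; rewrite trmx_mul trmxK mulmxA -(mulmxA v) vM mul0mx mxE//.
have fr : row_free M^T by rewrite /row_free mxrank_tr rM.
have : v *m M^T = 0 by rewrite -[v]trmxK -trmx_mul M0 trmx0.
by move/eqP; rewrite -[0](mul0mx _ M^T) => /eqP /(row_free_inj fr).
Qed.

(** The columns of [H] lie in the span of the first [s] coordinate vectors and are independent,
    hence span it, so the projection is a coordinate one. Concretely [H = E *m T] with [T]
    invertible, and [T] cancels. *)
Lemma projection_triangular n s (H : 'M[R]_(n, s)) : (s <= n)%N ->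
  (forall (i : 'I_n) j, (s <= i)%N -> H i j = 0) -> H^T *m H \in unitmx ->
  H *m invmx (H^T *m H) *m H^T = \matrix_(i, j) ((i == j) && (i < s)%N)%:R.
Proof.
move=> sn H0 uH.
pose E : 'M[R]_(n, s) := pid_mx s.
have ETE : E^T *m E = 1%:M.
  by rewrite /E tr_pid_mx mul_pid_mx minnn (minn_idPr sn) pid_mx_1.
have EEt : E *m E^T = \matrix_(i, j) ((i == j) && (i < s)%N)%:R.
  rewrite /E tr_pid_mx mul_pid_mx !minnn.
  by apply/matrixP => i j; rewrite !mxE.
have [T HE] : exists T : 'M[R]_s, H = E *m T.
  exists (E^T *m H); rewrite mulmxA EEt; apply/matrixP => i j; rewrite mxE (bigD1 i)//= !mxE eqxx/=.
  rewrite big1 ?addr0 => [|k /negbTE ki]; last by rewrite mxE eq_sym ki mul0r.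
  by case: ltnP => [_|si]; rewrite ?mul1r// mul0r H0.
have HTT : H^T *m H = T^T *m T.
  by rewrite HE trmx_mul -mulmxA (mulmxA E^T) ETE mul1mx.
have uT : T \in unitmx.
  by move: uH; rewrite HTT unitmx_mul unitmx_tr => /andP[].
rewrite HTT -EEt {1 2}HE trmx_mul.
rewrite -!mulmxA; congr (_ *m _).
have -> : invmx (T^T *m T) = invmx T *m invmx T^T.
  have uTT : T^T *m T \in unitmx by rewrite -HTT.
  rewrite -[RHS](mulKmx uTT) -!mulmxA (mulmxA T) mulmxV// mul1mx mulmxV ?unitmx_tr//.
  by rewrite mulmx1.
by rewrite -!mulmxA (mulmxA (invmx T^T)) mulVmx ?unitmx_tr// mul1mx mulmxA mulmxV// mul1mx.
Qed.

End gram.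

(** * Independent families with densities *)

Section independence.
Context d (T : measurableType d) (R : realType) (P : probability T R) (n : nat).
Local Notation mu := (@lebesgue_measure R).
Implicit Types (S : {set 'I_n}) (z : 'I_n -> T -> R) (f : 'I_n -> R -> R) (i j : 'I_n).

(** [S] is the set of live indices. Merging two coordinates removes an index from [S] without
    changing the index type, so an induction can combine coordinates while [z] and [f] stay families
    over ['I_n]. *)
Definition indep_density S z f :=
  [/\ forall i, measurable_fun setT (z i),
      forall i, measurable_fun setT (f i),
      forall i x, 0 <= f i x,
      forall i, (\int[mu]_x (f i x)%:E = 1)%E &
      forall B : 'I_n -> set R, (forall i, measurable (B i)) ->
        P [set w | forall i, i \in S -> B i (z i w)] =
        (\prod_(i in S) \int[mu]_(x in B i) (f i x)%:E)%E].

Definition upd (V : Type) (g : 'I_n -> V) i (v : V) : 'I_n -> V :=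
  fun l => if l == i then v else g l.

Lemma updE (V : Type) (g : 'I_n -> V) i v : upd g i v i = v.
Proof. by rewrite /upd eqxx. Qed.

Lemma upd_neq (V : Type) (g : 'I_n -> V) i v l : l != i -> upd g i v l = g l.
Proof. by rewrite /upd => /negbTE->. Qed.

Lemma measurable_event S z (B : 'I_n -> set R) :
  (forall i, measurable_fun setT (z i)) -> (forall i, measurable (B i)) ->
  measurable [set w | forall i, i \in S -> B i (z i w)].
Proof.
move=> mz mB.
rewrite (_ : mkset _ = \bigcap_(i in [set i | i \in S]) (z i @^-1` B i)); last first.
  by apply/seteqP; split => w /= h i; exact: h.
apply: fin_bigcap_measurable; first exact: finite_finset.
by move=> i _; rewrite -[X in measurable X]setTI; exact: mz.
Qed.

(** Restricting [P] to the event on the other coordinates gives a finite measure satisfying the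
    rectangle formula for [(z i, z j)]; [joint_density_integral] then extends it from rectangles to
    any measurable [D]. *)
Lemma indep_density_pair S z f i j (B : 'I_n -> set R) (D : set (R * R)) :
  indep_density S z f -> i \in S -> j \in S -> i != j ->
  (forall l, measurable (B l)) -> measurable D ->
  P ([set w | D (z i w, z j w)] `&` [set w | forall l, l \in S :\ i :\ j -> B l (z l w)]) =
  ((\prod_(l in S :\ i :\ j) \int[mu]_(x in B l) (f l x)%:E) *
   \int[mu]_x \int[mu]_y (\1_D (x, y) * (f i x * f j y))%:E)%E.
Proof.
move=> [mz mf f0 f1 zf] iS jS ij mB mD.
set E := [set w | forall l, l \in S :\ i :\ j -> B l (z l w)].
have mE : measurable E by exact: measurable_event.
pose Q : {measure set T -> \bar R} := mrestr P mE.
have jSi : j \in S :\ i by rewrite in_setD1 eq_sym ij.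
have rect A A' : measurable A -> measurable A' ->
    Q (z i @^-1` A `&` z j @^-1` A') =
    ((\prod_(l in S :\ i :\ j) \int[mu]_(x in B l) (f l x)%:E) *
     (\int[mu]_(x in A) (f i x)%:E * \int[mu]_(x in A') (f j x)%:E))%E.
  move=> mA mA'.
  pose B' := upd (upd B i A) j A'.
  have mB' l : measurable (B' l).
    by rewrite /B' /upd; case: ifP => // _; case: ifP.
  have Bi : B' i = A by rewrite /B' upd_neq// updE.
  have Bj : B' j = A' by rewrite /B' updE.
  have QE X : Q X = P (X `&` E) by [].
  rewrite QE (_ : _ `&` _ `&` E = [set w | forall l, l \in S -> B' l (z l w)]).
    rewrite zf// (big_setD1 i)//= (big_setD1 j)//= Bi Bj muleA muleC; congr (_ * _)%E.
    apply: eq_bigr => l; rewrite !in_setD1 => /and3P[lj li _].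
    by rewrite /B' !upd_neq.
  apply/seteqP; split => w /=.
    move=> [[wA wA'] wE] l lS; have [->|lj] := eqVneq l j; first by rewrite Bj.
    have [->|li] := eqVneq l i; first by rewrite Bi.
    by rewrite /B' !upd_neq//; apply: wE; rewrite !in_setD1 lj li.
  move=> h; split; first by split; [rewrite -Bi|rewrite -Bj]; exact: h.
  move=> l; rewrite !in_setD1 => /and3P[lj li lS].
  by have := h l lS; rewrite /B' !upd_neq.
have QT : Q setT = (\prod_(l in S :\ i :\ j) \int[mu]_(x in B l) (f l x)%:E)%E.
  by rewrite -[setT](setTI setT) -[X in X `&` _](preimage_setT (z i))
    -[X in _ `&` X](preimage_setT (z j)) rect// !f1 !mule1.
have Qfin : (Q setT < +oo)%E.
  have -> : Q setT = P E by rewrite -[LHS]/(P (setT `&` E)) setTI.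
  by apply: le_lt_trans (probability_le1 _ mE) _; rewrite ltry.
have mI : measurable_fun setT (fun z : R * R => (\1_D z)%:E : \bar R).
  exact/measurable_EFinP/measurable_indic.
have I0 (u : R * R) : (0 <= (\1_D u)%:E :> \bar R)%E by rewrite lee_fin.
have := joint_density_integral (Q := Q) Qfin (mz i) (mz j) (mf i) (f0 i) (mf j) (f0 j) _ mI I0.
rewrite QT => /(_ rect).
have mD' : measurable [set w | D (z i w, z j w)].
  have : measurable_fun setT (fun w => (z i w, z j w)) by apply/measurable_fun_pairP; split; exact: mz.
  by move=> /(_ measurableT _ mD); rewrite setTI.
rewrite (_ : (\int[Q]_w _)%E = P ([set w | D (z i w, z j w)] `&` E)); last first.
  by rewrite -[RHS]/(Q _) -[X in _ = Q X]setIT -integral_indic.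
move=> ->; congr (_ * _)%E; apply: eq_integral => x _; apply: eq_integral => y _.
Qed.

(** The combined coordinate is stored at [i] and [j] is retired from [S]. The hypothesis on [op]
    says that [g] is the density of [op] under the product of [f i] and [f j]. *)
Lemma indep_density_merge S z f i j (op : R * R -> R) (g : R -> R) :
  indep_density S z f -> i \in S -> j \in S -> i != j ->
  measurable_fun setT op -> measurable_fun setT g -> (forall x, 0 <= g x) ->
  (\int[mu]_x (g x)%:E = 1)%E ->
  (forall A, measurable A ->
    \int[mu]_x \int[mu]_y (\1_A (op (x, y)) * (f i x * f j y))%:E =
    \int[mu]_(x in A) (g x)%:E)%E ->
  indep_density (S :\ j) (upd z i (fun w => op (z i w, z j w))) (upd f i g).
Proof.
move=> zf iS jS ij mop mg g0 g1 opg; have [mz mf f0 f1 _] := zf.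
split.
- move=> l; rewrite /upd; case: ifP => // _; apply: measurableT_comp => //.
  by apply/measurable_fun_pairP; split; exact: mz.
- by move=> l; rewrite /upd; case: ifP.
- by move=> l x; rewrite /upd; case: ifP.
- by move=> l; rewrite /upd; case: ifP.
move=> B mB.
have mD : measurable (op @^-1` B i) by rewrite -[X in measurable X]setTI; exact: mop.
have iSj : i \in S :\ j by rewrite in_setD1 ij.
have SijE : S :\ j :\ i = S :\ i :\ j by apply/setP => l; rewrite !in_setD1 andbCA.
rewrite (big_setD1 i)//= updE SijE muleC.
rewrite (eq_bigr (fun l => \int[mu]_(x in B l) (f l x)%:E)%E); last first.
  by move=> l; rewrite !in_setD1 => /and3P[_ li _]; rewrite upd_neq.
rewrite -opg//.
rewrite -(@indep_density_pair S z f i j B _ zf iS jS ij mB mD); congr (P _).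
apply/seteqP; split => w /=.
  move=> h; split; first by have := h i iSj; rewrite updE.
  move=> l; rewrite !in_setD1 => /and3P[lj li lS].
  by have := h l; rewrite in_setD1 lj upd_neq//; exact.
move=> [wi h] l; rewrite in_setD1 => /andP[lj lS].
have [->|li] := eqVneq l i; first by rewrite updE.
by rewrite upd_neq//; apply: h; rewrite !in_setD1 lj li.
Qed.

Lemma indep_density_map S z f i (op : R -> R) (g : R -> R) :
  indep_density S z f -> 
  measurable_fun setT op -> measurable_fun setT g -> (forall x, 0 <= g x) ->
  (\int[mu]_x (g x)%:E = 1)%E ->
  (forall A, measurable A ->
    \int[mu]_(x in op @^-1` A) (f i x)%:E = \int[mu]_(x in A) (g x)%:E)%E ->
  indep_density S (upd z i (op \o z i)) (upd f i g).
Proof.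
move=> [mz mf f0 f1 zf] mop mg g0 g1 opg.
split.
- by move=> l; rewrite /upd; case: ifP => // _; exact: measurableT_comp.
- by move=> l; rewrite /upd; case: ifP.
- by move=> l x; rewrite /upd; case: ifP.
- by move=> l; rewrite /upd; case: ifP.
move=> B mB.
pose B' := upd B i (op @^-1` B i).
have mB' l : measurable (B' l).
  rewrite /B' /upd; case: ifP => // _.
  by rewrite -[X in measurable X]setTI; exact: mop.
rewrite (eq_bigr (fun l => \int[mu]_(x in B' l) (f l x)%:E)%E); last first.
  move=> l _; rewrite /B' /upd; case: eqP => // ->; by rewrite opg.
rewrite -zf//; congr (P _); apply/seteqP; split => w /= h l lS;
  by have := h l lS; rewrite /B' /upd; case: eqP => // ->.
Qed.

(** Marginalisation: put [setT] at the dropped indices, where each density integrates to 1. *)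
Lemma indep_densityS S S' z f : S' \subset S -> indep_density S z f ->
  indep_density S' z f.
Proof.
move=> SS [mz mf f0 f1 zf]; split => // B mB.
pose B' l := if l \in S' then B l else setT.
have mB' l : measurable (B' l) by rewrite /B'; case: ifP.
have := zf B' mB'.
rewrite (_ : [set w | _] = [set w | forall i, i \in S' -> B i (z i w)]); last first.
  apply/seteqP; split => w /= h l lS.
    by have := h l (fintype.subsetP SS l lS); rewrite /B' lS.
  by rewrite /B'; case: ifP => // lS'; exact: h.
move=> ->; rewrite (big_setID S')/= (finset.setIidPr SS) [X in (_ * X)%E]big1 ?mule1.
  by apply: eq_bigr => l lS; rewrite /B' lS.
by move=> l; rewrite inE => /andP[lS _]; rewrite /B' (negbTE lS).
Qed.

Lemma eq_indep_density S z z' f f' : z =2 z' -> f =2 f' ->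
  indep_density S z f -> indep_density S z' f'.
Proof.
by move=> zz ff; have -> : z = z' by [apply/funext => l; apply/funext => w; exact: zz];
  have -> : f = f' by [apply/funext => l; apply/funext => w; exact: ff].
Qed.

(** The product of two equal centred Gaussians depends only on [x^2 + y^2], and planar Lebesgue
    measure is rotation invariant; the remaining coordinates ride along through
    [indep_density_pair]. *)
Lemma indep_density_rotation S z f i j (c s k K : R) :
  indep_density S z f -> i \in S -> j \in S -> i != j -> c ^+ 2 + s ^+ 2 = 1 ->
  (forall x, f i x = gauss k x / K) -> (forall x, f j x = gauss k x / K) ->
  indep_density S (upd (upd z i (fun w => c * z i w + s * z j w))
                      j (fun w => - s * z i w + c * z j w)) f.
Proof.
move=> zf iS jS ij cs1 fi fj; have [mz mf f0 f1 _] := zf.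
split => //.
  by move=> l; rewrite /upd; case: ifP => _; [|case: ifP => _ //];
    apply: measurable_funD; apply: measurable_funM.
move=> B mB.
pose D := [set u : R * R | B i (c * u.1 + s * u.2) /\ B j (- s * u.1 + c * u.2)].
have mlin (a b : R) : measurable_fun setT (fun u : R * R => a * u.1 + b * u.2).
  by apply: measurable_funD; apply: measurable_funM.
have mD : measurable D.
  rewrite (_ : D = (fun u : R * R => c * u.1 + s * u.2) @^-1` B i `&`
     (fun u : R * R => - s * u.1 + c * u.2) @^-1` B j)//.
  apply: measurableI; rewrite -[X in measurable X]setTI; exact: mlin.
have jSi : j \in S :\ i by rewrite in_setD1 eq_sym ij.
rewrite (big_setD1 i)//= (big_setD1 j)//= muleA muleC.
have -> : (\int[mu]_(x in B i) (f i x)%:E * \int[mu]_(x in B j) (f j x)%:E =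
   \int[mu]_x \int[mu]_y (\1_D (x, y) * (f i x * f j y))%:E)%E.
  pose H u : \bar R := (\1_(B i `*` B j) u * (f i u.1 * f j u.2))%:E.
  have mH : measurable_fun setT H.
    apply/measurable_EFinP; apply: measurable_funM.
      by apply: measurable_indic; exact: measurableX.
    by apply: measurable_funM; exact: measurableT_comp.
  have H0 u : (0 <= H u)%E by rewrite lee_fin !mulr_ge0.
  transitivity (\int[mu]_x \int[mu]_y H (x, y))%E.
    have mIf l : measurable_fun setT (fun x => (\1_(B l) x * f l x)%:E).
      by apply/measurable_EFinP/measurable_funM => //; exact: measurable_indic.
    have If0 l x : (0 <= (\1_(B l) x * f l x)%:E)%E by rewrite lee_fin mulr_ge0.
    have J0 : (0 <= \int[mu]_(x in B j) (f j x)%:E)%E.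
      by apply: integral_ge0 => x _; rewrite lee_fin.
    rewrite (integral_indicl mu (B i)) -ge0_integralZr//; last exact: mIf.
    apply: eq_integral => x _; rewrite integral_indicl -ge0_integralZl//; last exact: mIf.
    by apply: eq_integral => y _; rewrite /H -EFinM indicX/=; congr EFin; ring.
  rewrite -(integral_rotation cs1 mH H0).
  apply: eq_integral => x _; apply: eq_integral => y _; rewrite /H/=; congr EFin.
  congr (_ * _).
  rewrite !fi !fj /gauss mulrACA -expRD [RHS]mulrACA -expRD; congr (expR _ * _).
  transitivity (- (k * ((c ^+ 2 + s ^+ 2) * (x ^+ 2 + y ^+ 2)))); first by ring.
  by rewrite cs1; ring.
rewrite -(@indep_density_pair S z f i j B _ zf iS jS ij mB mD); congr (P _).
apply/seteqP; split => w /=.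
  move=> h; split.
    split; first by have := h i iS; rewrite upd_neq// updE.
    by have := h j jS; rewrite updE.
  move=> l; rewrite !in_setD1 => /and3P[lj li lS].
  by have := h l lS; rewrite !upd_neq.
move=> [[wi wj] h] l lS.
have [->|lj] := eqVneq l j; first by rewrite updE.
rewrite upd_neq//; have [->|li] := eqVneq l i; first by rewrite updE.
by rewrite upd_neq//; apply: h; rewrite !in_setD1 lj li.
Qed.

End independence.

(** * Norms of disjoint blocks and their ratio *)

Section norms.
Context d (T : measurableType d) (R : realType) (P : probability T R) (n : nat).
Local Notation mu := (@lebesgue_measure R).
Variables (k K : R).
Hypotheses (K0 : 0 < K) (KE : (\int[mu]_x (gauss k x)%:E = K%:E)%E).
Implicit Types (S : {set 'I_n}) (z : 'I_n -> T -> R) (f : 'I_n -> R -> R) (i j : 'I_n).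

Lemma indep_density_integral S z f i j (h : R * R -> \bar R) :
  indep_density P S z f -> i \in S -> j \in S -> i != j ->
  measurable_fun setT h -> (forall u, 0 <= h u)%E ->
  (\int[P]_w h (z i w, z j w) =
   \int[mu]_x \int[mu]_y (h (x, y) * (f i x * f j y)%:E))%E.
Proof.
move=> zf iS jS ij mh h0.
have SS : [set i; j]%SET \subset S.
  by apply/fintype.subsetP => l; rewrite !inE => /orP[] /eqP->.
have [mz mf f0 f1 zf2] := indep_densityS SS zf.
have rect A B : measurable A -> measurable B -> P (z i @^-1` A `&` z j @^-1` B) =
    (P setT * (\int[mu]_(x in A) (f i x)%:E * \int[mu]_(x in B) (f j x)%:E))%E.
  move=> mA mB; rewrite probability_setT mul1e.
  pose B' l := if l == i then A else B.
  have mB' l : measurable (B' l) by rewrite /B'; case: ifP.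
  have := zf2 B' mB'; rewrite big_setU1 ?inE//= big_set1 /B' eqxx eq_sym (negbTE ij) => <-.
  congr (P _); apply/seteqP; split => w /=.
    by move=> [wA wB] l; rewrite !inE => /orP[] /eqP->; rewrite ?eqxx// eq_sym (negbTE ij).
  move=> H; split; first by have := H i; rewrite !inE eqxx; exact.
  by have := H j; rewrite !inE eqxx orbT eq_sym (negbTE ij); exact.
have Pfin : (P setT < +oo)%E by rewrite probability_setT ltry.
rewrite (joint_density_integral (Q := P) Pfin (mz i) (mz j) (mf i) (f0 i) (mf j) (f0 j) rect)//.
rewrite [X in (X * _)%E](_ : _ = 1%E) ?mul1e//; exact: probability_setT.
Qed.

Lemma integral_rpdf N : (\int[mu]_x (rpdf k N x)%:E = 1)%E.
Proof.
have M0 := rmass_gt0 K0 KE N.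
under eq_integral do rewrite /rpdf mulrC EFinM.
rewrite ge0_integralZl//; last 3 first.
- by apply/measurable_EFinP; exact: measurable_radial.
- by move=> x _; rewrite lee_fin radial_ge0.
- by rewrite lee_fin invr_ge0 ltW.
by rewrite (rmassE K0 KE) -EFinM mulVf// gt_eqF.
Qed.

(** Index [i] accumulates the norm: it starts as [|z i|] and absorbs the members of [J] one by one,
    each leaving [S]. With [size J + 1] coordinates the exponent is [size J]. *)
Lemma indep_density_norm S z f i (J : seq 'I_n) :
  indep_density P S z f -> i \in S -> uniq J -> i \notin J -> {subset J <= S} ->
  (forall j, j \in i :: J -> forall x, f j x = gauss k x / K) ->
  indep_density P (S :\: [set j in J])
    (upd z i (fun w => Num.sqrt (\sum_(j <- i :: J) z j w ^+ 2)))
    (upd f i (rpdf k (size J))).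
Proof.
move=> zf iS; elim: J => [|j J IH] /= uJ iJ JS fJ.
  have -> : S :\: [set j in [::]] = S by apply/setP => l; rewrite !inE.
  apply: eq_indep_density (indep_density_map (i := i) (op := Num.norm) (g := rpdf k 0) zf _ _ _ _ _) => //.
  - by move=> l w; rewrite /upd; case: eqP => // _; rewrite big_seq1 sqrtr_sqr.
  - exact: measurable_rpdf.
  - exact: (rpdf_ge0 K0 KE).
  - exact: integral_rpdf.
  - move=> A mA; rewrite integral_indicl [RHS]integral_indicl.
    have mI : measurable_fun setT (fun x : R => (\1_A x)%:E : \bar R).
      exact/measurable_EFinP/measurable_indic.
    have I0 x : (0 <= (\1_A x)%:E :> \bar R)%E by rewrite lee_fin.
    transitivity (\int[mu]_x ((\1_A `|x|%R)%:E * (gauss k x / K)%:E))%E.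
      by apply: eq_integral => x _; rewrite fJ ?mem_head// -EFinM.
    by rewrite (integral_rpdf0_abs K0 KE mI I0); apply: eq_integral => x _; rewrite -EFinM.
have [jJ uJ'] := andP uJ.
have [ij iJ'] : i != j /\ i \notin J by move: iJ; rewrite in_cons negb_or => /andP[].
have jS : j \in S by apply: JS; exact: mem_head.
have {}IH := IH uJ' iJ' _ _.
have {IH} zJ : indep_density P (S :\: [set j in J])
    (upd z i (fun w => Num.sqrt (\sum_(j <- i :: J) z j w ^+ 2)))
    (upd f i (rpdf k (size J))).
  apply: IH => l lJ; first by apply: JS; rewrite in_cons lJ orbT.
  by apply: fJ; move: lJ; rewrite !in_cons => /orP[->|->]//; rewrite !orbT.
have -> : S :\: [set l in j :: J] = (S :\: [set l in J]) :\ j.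
  by apply/setP => l; rewrite !inE negb_or andbA.
pose op (u : R * R) := Num.sqrt (u.1 ^+ 2 + u.2 ^+ 2).
have mop : measurable_fun setT op.
  apply: measurableT_comp => //.
    by apply: continuous_measurable_fun; exact: sqrt_continuous.
  by apply: measurable_funD; apply: measurable_funX.
apply: eq_indep_density (indep_density_merge (i := i) (j := j) (op := op)
   (g := rpdf k (size J).+1) zJ _ _ ij mop _ _ _ _).
- move=> l w; rewrite /upd eqxx; case: ifP => [_|-> //].
  rewrite eq_sym (negbTE ij) /op/= sqr_sqrtr; last by apply: sumr_ge0 => l' _; exact: sqr_ge0.
  by rewrite !big_cons; congr Num.sqrt; ring.
- by move=> l x; rewrite /upd; case: ifP => [_|-> //].
- by rewrite !inE iS andbT.
- by rewrite !inE jS andbT.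
- exact: measurable_rpdf.
- exact: (rpdf_ge0 K0 KE).
- exact: integral_rpdf.
- move=> A mA; rewrite updE upd_neq 1?eq_sym// integral_indicl.
  have mI : measurable_fun setT (fun x : R => (\1_A x)%:E : \bar R).
    exact/measurable_EFinP/measurable_indic.
  have I0 x : (0 <= (\1_A x)%:E :> \bar R)%E by rewrite lee_fin.
  transitivity (\int[mu]_r \int[mu]_x
      ((\1_A (Num.sqrt (r ^+ 2 + x ^+ 2)))%:E * (rpdf k (size J) r * (gauss k x / K))%:E))%E.
    apply: eq_integral => r _; apply: eq_integral => x _.
    by rewrite fJ ?in_cons ?eqxx ?orbT// -EFinM.
  by rewrite (integral_rpdf_polar K0 KE _ mI I0); apply: eq_integral => x _; rewrite -EFinM.
Qed.

Lemma indep_density_block S z f i (A : {set 'I_n}) :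
  indep_density P S z f -> A \subset S -> i \in A ->
  (forall j, j \in A -> forall x, f j x = gauss k x / K) ->
  indep_density P (S :\: (A :\ i))
    (upd z i (fun w => Num.sqrt (\sum_(j in A) z j w ^+ 2)))
    (upd f i (rpdf k #|A|.-1)).
Proof.
move=> zf AS iA fA.
have iS : i \in S by exact: (fintype.subsetP AS).
have -> : #|A|.-1 = size (enum (A :\ i)) by rewrite -cardE (cardsD1 i A) iA.
have -> : S :\: (A :\ i) = S :\: [set j in enum (A :\ i)].
  by congr (_ :\: _); apply/setP => j; rewrite !inE mem_enum !inE.
have inA j : j \in enum (A :\ i) -> j \in A by rewrite mem_enum !inE => /andP[].
apply: eq_indep_density (indep_density_norm (J := enum (A :\ i)) zf iS _ _ _ _) => //.
- move=> l w; rewrite /upd; case: ifP => // _.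
  by rewrite big_cons big_enum/= (big_setD1 i iA).
- exact: enum_uniq.
- by rewrite mem_enum !inE eqxx.
- by move=> j /inA; exact: (fintype.subsetP AS).
- by move=> j; rewrite in_cons => /orP[/eqP->|/inA]; exact: fA.
Qed.

(** One representative of each block accumulates its norm. Disjointness ensures that the first
    accumulation leaves the second block Gaussian and both representatives live. *)
Lemma indep_density_two_norms z (A1 A2 : {set 'I_n}) (h : R * R -> \bar R) :
  indep_density P finset.setT z (fun _ x => gauss k x / K) ->
  (0 < #|A1|)%N -> (0 < #|A2|)%N -> (forall j, j \in A2 -> j \notin A1) ->
  measurable_fun setT h -> (forall u, 0 <= h u)%E ->
  (\int[P]_w h (Num.sqrt (\sum_(j in A1) z j w ^+ 2)%R, Num.sqrt (\sum_(j in A2) z j w ^+ 2)%R) =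
   \int[mu]_x \int[mu]_y (h (x, y) * (rpdf k #|A1|.-1 x * rpdf k #|A2|.-1 y)%:E))%E.
Proof.
move=> zf /card_gt0P[i1 i1A] /card_gt0P[i2 i2A] d12 mh h0.
have zf1 := indep_density_block zf (finset.subsetT A1) i1A (fun _ _ _ => erefl).
have ne j : j \in A2 -> j != i1 by move=> /d12; apply: contraNneq => ->.
have A2S : A2 \subset finset.setT :\: (A1 :\ i1).
  by apply/fintype.subsetP => j jA; rewrite !inE (negbTE (d12 _ jA)) andbF.
have fA2 j : j \in A2 -> forall x,
    upd (fun=> fun x => gauss k x / K) i1 (rpdf k #|A1|.-1) j x = gauss k x / K.
  by move=> jA x; rewrite upd_neq// ne.
have zf2 := indep_density_block zf1 A2S i2A fA2.
have i12 : i1 != i2 by rewrite eq_sym ne.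
have m1 : i1 \in finset.setT :\: (A1 :\ i1) :\: (A2 :\ i2).
  by rewrite !inE eqxx (negbTE (contraL (d12 i1) i1A)) andbF.
have m2 : i2 \in finset.setT :\: (A1 :\ i1) :\: (A2 :\ i2).
  by rewrite !inE eqxx/= (negbTE (d12 _ i2A)) andbF.
have E := indep_density_integral zf2 m1 m2 i12 mh h0.
apply: etrans (etrans E _).
- apply: eq_integral => w _; rewrite updE upd_neq// updE; congr (h (_, Num.sqrt _)).
  by apply: eq_bigr => j jA; rewrite upd_neq// ne.
- apply: eq_integral => x _; apply: eq_integral => y _.
  by rewrite updE upd_neq// updE.
Qed.

(* Substitute [u = l v x], exchange, then substitute [w = v sqrt (1 + (l x)^2)]. *)
Lemma integral_ratio N1 N2 (l : R) (g : R -> \bar R) : 0 < l ->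
  measurable_fun setT g -> (forall x, 0 <= g x)%E ->
  (\int[mu]_u \int[mu]_v (g (u / (l * v))%R * (v * (radial k N1 u * radial k N2 v))%:E) =
   (rmass k (N1 + N2).+2 * l ^+ N1.+1)%:E *
   \int[mu]_(x in `]0%R, +oo[)
     (g x * (x ^+ N1 * (Num.sqrt (1 + (l * x) ^+ 2))^-1 ^+ (N1 + N2).+3)%:E))%E.
Proof.
move=> l0 mg g0.
pose N := (N1 + N2).+2.
have rad0 m (v : R) : v <= 0 -> radial k m v = 0.
  by move=> v0; rewrite radialE ltNge v0.
have nneg m (v : R) : 0 <= v * radial k m v.
  have [v0|v0] := leP v 0; first by rewrite rad0// mulr0.
  by rewrite mulr_ge0 ?radial_ge0// ltW.
pose L (z : R * R) : \bar R := (g (z.1 / (l * z.2))%R * (z.2 * (radial k N1 z.1 * radial k N2 z.2))%:E)%E.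
have mL : measurable_fun setT L.
  apply: emeasurable_funM.
    apply: (measurableT_comp mg); apply: measurable_funM => //.
    by apply: (measurableT_comp (@measurable_invr R)); apply: measurable_funM.
  apply/measurable_EFinP; apply: measurable_funM => //; apply: measurable_funM;
    by apply: measurableT_comp => //; exact: measurable_radial.
have L0 (u : R * R) : (0 <= L u)%E.
  by rewrite mule_ge0// lee_fin mulrCA mulr_ge0 ?radial_ge0.
pose H (z : R * R) : \bar R := (g z.1 * (l * z.2 * (z.2 * (radial k N1 (l * z.2 * z.1) * radial k N2 z.2)))%:E)%E.
have mH : measurable_fun setT H.
  apply: emeasurable_funM; first exact: measurableT_comp.
  apply/measurable_EFinP.
  have mlz : measurable_fun setT (fun z : R * R => l * z.2) by exact: measurable_funM.
  apply: measurable_funM => //; apply: measurable_funM => //; apply: measurable_funM.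
    apply: measurableT_comp; first exact: measurable_radial.
    exact: measurable_funM.
  by apply: measurableT_comp => //; exact: measurable_radial.
have H0 (u : R * R) : (0 <= H u)%E.
  rewrite mule_ge0// lee_fin.
  have [v0|v0] := leP u.2 0; first by rewrite (rad0 _ _ v0) !mulr0.
  have v1 := ltW v0; have l1 := ltW l0.
  apply: mulr_ge0; first exact: mulr_ge0.
  by apply: mulr_ge0 => //; rewrite mulr_ge0 ?radial_ge0.
rewrite (lebesgue_tonelli mL L0).
transitivity (\int[mu]_v \int[mu]_x H (x, v))%E.
  apply: eq_integral => v _.
  have [v0|v0] := leP v 0.
    by rewrite !integral0_eq// => x _; rewrite /L /H/= (rad0 _ _ v0) !mulr0 mule0.
  have lv0 : 0 < l * v by exact: mulr_gt0.
  have mLv : measurable_fun setT (fun u => L (u, v)) by exact: measurable_secr.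
  have mLa : measurable_fun setT (fun u => L (l * v * u + 0, v)).
    exact: (measurableT_comp mLv (measurable_affine _ _)).
  rewrite [LHS](@integral_affine_pos _ (l * v) 0)// -ge0_integralZl//; last first.
    by rewrite lee_fin ltW.
  apply: eq_integral => x _; rewrite addr0 /L /H/= muleCA -EFinM.
  by congr (g _ * _)%E; field; rewrite !gt_eqF.
rewrite -(lebesgue_tonelli mH H0).
pose b x := Num.sqrt (1 + (l * x) ^+ 2).
have b0 x : 0 < b x by rewrite sqrtr_gt0 ltr_pwDl ?sqr_ge0.
have M0 : 0 < rmass k N by exact: (rmass_gt0 K0 KE).
have c0 : (0 <= (rmass k N * l ^+ N1.+1)%:E)%E.
  by rewrite lee_fin mulr_ge0 ?exprn_ge0 ?ltW.
have mb : measurable_fun setT b.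
  apply: measurableT_comp => //.
    by apply: continuous_measurable_fun; exact: sqrt_continuous.
  by apply: measurable_funD => //; apply: measurable_funX; exact: measurable_funM.
have mG : measurable_fun (`]0%R, +oo[%classic : set R)
    (fun x => g x * (x ^+ N1 * (b x)^-1 ^+ (N1 + N2).+3)%:E)%E.
  apply: measurable_funTS; apply: emeasurable_funM => //; apply/measurable_EFinP.
  apply: measurable_funM; first exact: measurable_funX.
  by apply: measurable_funX; exact: (measurableT_comp (@measurable_invr R)).
have G0 x : (`]0%R, +oo[%classic : set R) x ->
    (0 <= g x * (x ^+ N1 * (b x)^-1 ^+ (N1 + N2).+3)%:E)%E.
  rewrite /= in_itv/= andbT => x0; rewrite mule_ge0// lee_fin mulr_ge0 ?exprn_ge0 ?ltW//.
  by rewrite invr_gt0.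
rewrite -ge0_integralZl// integral_mkcond [RHS]integral_mkcond.
apply: eq_integral => x _; rewrite patch_setT patchE mem_setE in_itv/= andbT.
case: ifPn => [x0|]; last first.
  rewrite -leNgt => x0; apply: integral0_eq => v _; rewrite /H/=.
  have [v0|v0] := leP v 0; first by rewrite (rad0 _ _ v0) !mulr0 mule0.
  by rewrite (rad0 N1) ?mul0r ?mulr0 ?mule0// mulr_ge0_le0// ltW// mulr_gt0.
(* Collecting powers gives [l^(N1+1) x^N1 v^N], and the Gaussian exponents add up since
   [(l v x)^2 + v^2 = (b x * v)^2]. The inner integral thus becomes a mass of [radial k N], up to
   one more factor [1 / b x] from the substitution. *)
have radb v : (l * v * (v * (radial k N1 (l * v * x) * radial k N2 v))) =
    (l ^+ N1.+1 * x ^+ N1 * (b x)^-1 ^+ N) * radial k N (b x * v).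
  have [v0|v0] := leP v 0.
    by rewrite (rad0 _ _ v0) !mulr0 rad0 ?mulr0// mulr_ge0_le0// ltW.
  rewrite !radialE v0 !mulr_gt0//.
  have -> : gauss k (b x * v) = gauss k (l * v * x) * gauss k v.
    rewrite /gauss -expRD exprMn sqr_sqrtr ?addr_ge0 ?sqr_ge0//; congr expR; ring.
  transitivity (((b x)^-1 * b x) ^+ N * (l ^+ N1.+1 * x ^+ N1 * v ^+ N) *
      (gauss k (l * v * x) * gauss k v)); last by rewrite !exprMn; ring.
  rewrite mulVf ?gt_eqF// expr1n /N !exprMn !exprS exprD; ring.
have mr : measurable_fun setT (fun v => (radial k N (b x * v + 0))%:E).
  apply/measurable_EFinP; apply: (measurableT_comp (measurable_radial k N)).
  exact: measurable_affine.
transitivity (\int[mu]_v ((g x * (l ^+ N1.+1 * x ^+ N1 * (b x)^-1 ^+ N)%:E) * (radial k N (b x * v + 0))%:E))%E.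
  by apply: eq_integral => v _; rewrite /H/= radb addr0 EFinM muleA.
have gx0 : (0 <= g x * (l ^+ N1.+1 * x ^+ N1 * (b x)^-1 ^+ N)%:E)%E.
  rewrite mule_ge0// lee_fin; apply: mulr_ge0; first apply: mulr_ge0;
    by apply: exprn_ge0; rewrite ?invr_ge0 ltW.
rewrite ge0_integralZl//; last by move=> v _; rewrite lee_fin radial_ge0.
have -> : (\int[mu]_v (radial k N (b x * v + 0))%:E = (rmass k N / b x)%:E)%E.
  have mrk : measurable_fun setT (fun v => (radial k N v)%:E).
    by apply/measurable_EFinP; exact: measurable_radial.
  have rk0 v : (0 <= (radial k N v)%:E)%E by rewrite lee_fin radial_ge0.
  have := integral_affine_pos 0 (b0 x) mrk rk0.
  rewrite (rmassE K0 KE).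
  case: (\int[mu]_v (radial k N (b x * v + 0))%:E)%E => [r| |].
  - by move=> [->]; congr EFin; field; rewrite gt_eqF.
  - by rewrite mulry gtr0_sg// mul1e.
  - by rewrite mulrNy gtr0_sg// mul1e.
rewrite -muleA -EFinM muleCA -EFinM; congr (_ * _%:E)%E.
have -> : (Num.sqrt (1 + (l * x) ^+ 2))^-1 ^+ (N1 + N2).+3 = (b x)^-1 * (b x)^-1 ^+ N.
  exact: exprS.
rewrite -/N; ring.
Qed.

End norms.

(** * Least squares in rotated coordinates *)

Section regression.
Context {R : realType} {n p s : nat}.
Variables (X : 'M[R]_(n, p)) (C : 'M[R]_(p, s)).
Hypotheses (rX : \rank X = p) (rC : \rank C = s).

Lemma rank_le_rows : (p <= n)%N.
Proof. by rewrite -rX rank_leq_row. Qed.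

Lemma rank_le_cols : (s <= p)%N.
Proof. by rewrite -rC rank_leq_row. Qed.

Lemma gramX_unitmx : X^T *m X \in unitmx.
Proof. exact: gram_unitmx. Qed.

Lemma trmx_XtXinv : (XtXinv X)^T = XtXinv X.
Proof. by rewrite /XtXinv trmx_inv trmx_mul trmxK. Qed.

(* [tauhat - tau = hypothesis_basis^T *m eps]. *)
Definition hypothesis_basis : 'M[R]_(n, s) := X *m (XtXinv X *m C).
Local Notation H := hypothesis_basis.

Lemma trmx_hypothesis_basis : H^T = C^T *m XtXinv X *m X^T.
Proof. by rewrite /H !trmx_mul trmx_XtXinv. Qed.

Lemma V22E : V22 C X = H^T *m H.
Proof.
rewrite trmx_hypothesis_basis /V22 /H -!mulmxA; congr (_ *m _); congr (_ *m _).
by rewrite mulmxA (mulmxA (X^T *m X)) mulmxV ?gramX_unitmx// mul1mx.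
Qed.

Lemma V22_unitmx : H^T *m H \in unitmx.
Proof.
apply: gram_unitmx; rewrite -mxrank_tr trmx_hypothesis_basis.
rewrite mxrankMfree; last by rewrite /row_free mxrank_tr rX.
rewrite mxrankMfree ?mxrank_tr//.
by rewrite row_free_unit /XtXinv unitmx_inv gramX_unitmx.
Qed.

Lemma v11E (a : 'cV[R]_p) :
  v11 a X = ((X *m (XtXinv X *m a))^T *m (X *m (XtXinv X *m a))) 0 0.
Proof.
suff <- : a^T *m XtXinv X *m a =
    (X *m (XtXinv X *m a))^T *m (X *m (XtXinv X *m a)) by [].
rewrite !trmx_mul trmx_XtXinv -!mulmxA; congr (_ *m _); congr (_ *m _).
by rewrite mulmxA (mulmxA (X^T *m X)) mulmxV ?gramX_unitmx// mul1mx.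
Qed.

Lemma v11_gt0 (a : 'cV[R]_p) : a != 0 -> 0 < v11 a X.
Proof.
move=> a0; rewrite v11E lt_neqAle eq_sym; apply/andP; split; last first.
  by rewrite mxE sumr_ge0// => i _; rewrite mxE -expr2 sqr_ge0.
apply: contraNneq a0 => /sqnorm_eq0 Xa.
have : (X^T *m X) *m (XtXinv X *m a) = 0 by rewrite -mulmxA Xa mulmx0.
by rewrite mulmxA mulmxV ?gramX_unitmx// mul1mx => ->.
Qed.

(* The basis [B] of R^p starts with one of the column space of (X^T X)^-1 C, so triangularizing
   [X B] puts both [X] and [hypothesis_basis] in echelon form. *)
Lemma orthogonal_canonical_form (Q : 'M[R]_n -> Prop) :
  Q 1%:M ->
  (forall (i j : 'I_n) (c u : R) O, i != j -> c ^+ 2 + u ^+ 2 = 1 -> Q O ->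
    Q (givens i j c u *m O)) ->
  exists O : 'M[R]_n, [/\ Q O, O^T *m O = 1%:M,
    forall (i : 'I_n) j, (p <= i)%N -> (O *m X) i j = 0 &
    forall (i : 'I_n) j, (s <= i)%N -> (O *m H) i j = 0].
Proof.
move=> Q1 QG.
pose D := XtXinv X *m C; pose B := col_ebase D.
have uB : B \in unitmx by exact: col_ebase_unit.
(* Orthogonality is itself stable under plane rotations, so it is added to the invariant. *)
have [|i j c u O ij cu [QO OO]|O [QO OO] OM] :=
    @givens_triangularization R n p (fun O => Q O /\ O^T *m O = 1%:M) (X *m B).
- by rewrite trmx1 mul1mx.
- split; first exact: QG.
  by rewrite trmx_mul -mulmxA (mulmxA (givens _ _ _ _)^T) givens_orthogonal// mul1mx.
exists O; split => // i j ij.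
- rewrite -[X](mulmxK uB) mulmxA mxE big1// => l _.
  by rewrite OM ?mul0r//; exact: leq_trans (ltn_ord l) ij.
(* [pid_mx] keeps only columns of [X *m B] with index below [s], and triangularity makes these
   vanish in rows [i >= s]. *)
- have -> : O *m H = O *m (X *m B) *m pid_mx (\rank D) *m row_ebase D.
    by rewrite /H -/D -[in LHS](mulmx_ebase D) -/B !mulmxA.
  rewrite mxE big1// => l _; rewrite mxE big1 ?mul0r// => q _.
  rewrite [pid_mx _ _ _]mxE; case: eqP => [ql|]; last by rewrite mulr0.
  rewrite OM ?mul0r//; rewrite ql; exact: leq_trans (ltn_ord l) ij.
Qed.

Variables (beta : 'cV[R]_p) (t : 'cV[R]_s) (E : 'cV[R]_n) (O : 'M[R]_n).
Hypotheses (O1 : O^T *m O = 1%:M) (tau0 : C^T *m beta - t = 0)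
  (OX : forall (i : 'I_n) j, (p <= i)%N -> (O *m X) i j = 0)
  (OH : forall (i : 'I_n) j, (s <= i)%N -> (O *m H) i j = 0).
Local Notation Y := (X *m beta + E).
Local Notation Z := (O *m E).

Lemma betahatE : betahat X Y = beta + XtXinv X *m X^T *m E.
Proof.
by rewrite /betahat mulmxDr mulmxA -(mulmxA _ X^T) mulVmx ?gramX_unitmx// mul1mx.
Qed.

Lemma tauhatE : tauhat C t X Y = H^T *m E.
Proof.
rewrite /tauhat betahatE mulmxDr addrAC tau0 add0r trmx_hypothesis_basis.
by rewrite !mulmxA.
Qed.

Lemma rotate_gram q (M : 'M[R]_(n, q)) : (O *m M)^T *m (O *m M) = M^T *m M.
Proof. by rewrite trmx_mul -mulmxA (mulmxA O^T) O1 mul1mx. Qed.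

Lemma diag_mul (q : nat) (v : 'cV[R]_n) (i : 'I_n) :
  ((\matrix_(i < n, j < n) ((i == j) && (i < q)%N)%:R) *m v) i 0 =
  if (i < q)%N then v i 0 else 0.
Proof.
rewrite mxE (bigD1 i)//= mxE eqxx/= big1 ?addr0 => [|l li].
  by case: ifP; rewrite ?mul1r ?mul0r.
by rewrite mxE eq_sym (negbTE li) mul0r.
Qed.

(** At [tau = 0] the quadratic form is [E^T] times the projection onto the columns of [H] times [E];
    in rotated coordinates this projection keeps the first [s] entries. *)
Lemma tauhat_norm :
  ((tauhat C t X Y)^T *m invmx (V22 C X) *m tauhat C t X Y) 0 0 =
  \sum_(i < n | (i < s)%N) Z i 0 ^+ 2.
Proof.
have HZ : H^T *m E = (O *m H)^T *m Z.
  by rewrite [in RHS]trmx_mul -mulmxA (mulmxA O^T) O1 mul1mx.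
have PE := projection_triangular (leq_trans rank_le_cols rank_le_rows) OH.
rewrite tauhatE V22E HZ.
move: PE; rewrite rotate_gram V22_unitmx => /(_ isT).
move: (H^T *m H) => W.
move: (O *m H) => G PE; rewrite trmx_mul trmxK -!mulmxA (mulmxA G) (mulmxA (G *m _)) PE.
rewrite mxE [RHS]big_mkcond/=; apply: eq_bigr => i _.
by rewrite diag_mul mxE; case: ifP; rewrite ?mulr0.
Qed.

(** The residual is [E] minus its projection onto the columns of [X]; in rotated coordinates the
    first [p] entries are removed. *)
Lemma residual_norm :
  \sum_i ((Y - X *m betahat X Y) i 0) ^+ 2 = \sum_(i < n | (p <= i)%N) Z i 0 ^+ 2.
Proof.
pose r := Y - X *m betahat X Y.
have rE : r = E - X *m XtXinv X *m X^T *m E.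
  by rewrite /r betahatE mulmxDr opprD addrACA subrr add0r !mulmxA.
have -> : \sum_i (r i 0) ^+ 2 = (r^T *m r) 0 0.
  by rewrite mxE; apply: eq_bigr => i _; rewrite [r^T _ _]mxE expr2.
rewrite -rotate_gram mxE.
have Or : O *m r = Z - (\matrix_(i < n, j < n) ((i == j) && (i < p)%N)%:R) *m Z.
  rewrite rE mulmxBr; congr (_ - _).
  rewrite -(@projection_triangular _ _ _ (O *m X)) ?rotate_gram ?gramX_unitmx ?rank_le_rows//.
  rewrite trmx_mul -!mulmxA (mulmxA O^T) O1 mul1mx//.
rewrite [RHS]big_mkcond/=; apply: eq_bigr => i _.
rewrite mxE -expr2 Or mxE [X in _ + X]mxE diag_mul ltnNge.
by case: (p <= i)%N; rewrite /= ?subr0 ?subrr ?expr0n.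
Qed.

End regression.

(** * Assembly *)

Section ratio_law.
Context {R : realType}.
Local Notation mu := (@lebesgue_measure R).
Variables (k K : R).
Hypotheses (K0 : 0 < K) (KE : (\int[mu]_x (gauss k x)%:E = K%:E)%E).

(** Normalised form of [integral_ratio]. The weight is [|v|], so that the integrand is nonnegative
    everywhere; it agrees with [v] wherever the density is nonzero. *)
Lemma integral_ratio_rpdf N1 N2 (l : R) (g : R -> \bar R) : 0 < l ->
  measurable_fun setT g -> (forall x, 0 <= g x)%E ->
  (\int[mu]_u \int[mu]_v (g (u / (l * v))%R * `|v|%:E * (rpdf k N1 u * rpdf k N2 v)%:E) =
   (rmass k (N1 + N2).+2 * l ^+ N1.+1 / (rmass k N1 * rmass k N2))%:E *
   \int[mu]_(x in `]0%R, +oo[)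
     (g x * (x ^+ N1 * (Num.sqrt (1 + (l * x) ^+ 2))^-1 ^+ (N1 + N2).+3)%:E))%E.
Proof.
move=> l0 mg g0.
have M1 := rmass_gt0 K0 KE N1; have M2 := rmass_gt0 K0 KE N2.
pose H (z : R * R) : \bar R :=
  (g (z.1 / (l * z.2))%R * (z.2 * (radial k N1 z.1 * radial k N2 z.2))%:E)%E.
have H0 z : (0 <= H z)%E.
  rewrite mule_ge0// lee_fin radialE [radial k N2 _]radialE.
  case: ifPn => z1; last by rewrite mul0r mulr0.
  case: ifPn => z2; last by rewrite !mulr0.
  by rewrite !mulr_ge0 ?gauss_ge0 ?exprn_ge0 ?ltW.
have mH : measurable_fun setT H.
  apply: emeasurable_funM.
    apply: (measurableT_comp mg); apply: measurable_funM => //.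
    by apply: (measurableT_comp (@measurable_invr R)); apply: measurable_funM.
  apply/measurable_EFinP; apply: measurable_funM => //; apply: measurable_funM;
    by apply: measurableT_comp => //; exact: measurable_radial.
pose q := (rmass k N1 * rmass k N2)^-1.
have q0 : (0 <= q%:E)%E by rewrite lee_fin invr_ge0 mulr_ge0 ?ltW.
have mF : measurable_fun setT (fun u => \int[mu]_v H (u, v))%E.
  exact: measurable_integral_secl.
have F0 u : (0 <= \int[mu]_v H (u, v))%E by exact: integral_ge0.
transitivity (q%:E * \int[mu]_u \int[mu]_v H (u, v))%E.
  rewrite -ge0_integralZl//; apply: eq_integral => u _.
  have mHu : measurable_fun setT (fun v => H (u, v)) by exact: measurable_secl.
  rewrite -ge0_integralZl//; apply: eq_integral => v _.
  rewrite /H/= muleCA -muleA -!EFinM; congr (_ * _%:E)%E.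
  have [v0|v0] := leP v 0.
    by rewrite /rpdf [radial k N2 v]radialE ltNge v0/= mul0r !mulr0.
  by rewrite /rpdf /q gtr0_norm//; field; rewrite !gt_eqF.
rewrite (integral_ratio K0 KE)// muleA -EFinM; congr (_%:E * _)%E.
by rewrite /q mulrC.
Qed.

(** Multiplying [radial k N2] by [v] gives [radial k N2.+1], so the first moment is a quotient of
    masses. *)
Lemma integral_rpdf_moment N1 N2 :
  (\int[mu]_u \int[mu]_v (`|v|%:E * (rpdf k N1 u * rpdf k N2 v)%:E) =
   (rmass k N2.+1 / rmass k N2)%:E)%E.
Proof.
have M1 := rmass_gt0 K0 KE N1; have M2 := rmass_gt0 K0 KE N2.
have M3 := rmass_gt0 K0 KE N2.+1.
have inner u : (\int[mu]_v (`|v|%:E * (rpdf k N1 u * rpdf k N2 v)%:E) =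
   (rpdf k N1 u)%:E * (rmass k N2.+1 / rmass k N2)%:E)%E.
  transitivity (\int[mu]_v ((rpdf k N1 u / rmass k N2)%:E * (radial k N2.+1 v)%:E))%E.
    apply: eq_integral => v _; rewrite -!EFinM; congr EFin.
    rewrite /rpdf [radial k N2 v]radialE [radial k N2.+1 v]radialE.
    case: ifPn => v0; last by rewrite mul0r !mulr0.
    by rewrite gtr0_norm// exprS; field; rewrite !gt_eqF.
  rewrite ge0_integralZl//; last 3 first.
  - by apply/measurable_EFinP; exact: measurable_radial.
  - by move=> x _; rewrite lee_fin radial_ge0.
  - by rewrite lee_fin divr_ge0 ?(rpdf_ge0 K0 KE)// ltW.
  by rewrite (rmassE K0 KE) -!EFinM; congr EFin; field; rewrite gt_eqF.
under eq_integral do rewrite inner.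
rewrite ge0_integralZr//; last 3 first.
- by apply/measurable_EFinP; exact: measurable_rpdf.
- by move=> x _; rewrite lee_fin (rpdf_ge0 K0 KE).
- by rewrite lee_fin divr_ge0// ltW.
by rewrite (integral_rpdf K0 KE) mul1e.
Qed.

Lemma Gamma_gt0 N : 0 < k -> 0 < Gamma (N.+1%:R / 2 : R).
Proof.
move=> k0; have := rmass_gt0 K0 KE N.
rewrite rmass_Gamma// pmulr_rgt0// mulr_gt0// powR_gt0//.
Qed.

End ratio_law.

(** * Matching the constants of the formula *)

Section constants.
Context {R : realType}.
Local Notation mu := (@lebesgue_measure R).

Lemma sqrt_exprn (x : R) n : 0 <= x -> Num.sqrt x ^+ n = x `^ (n%:R / 2).
Proof.
by move=> x0; rewrite -powR12_sqrt// -powR_mulrn ?powR_ge0// -powRrM mulrC.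
Qed.

Lemma powR_invr (x y : R) : 0 <= x -> x^-1 `^ y = x `^ (- y).
Proof. by move=> x0; rewrite -powR_inv1// -powRrM mulN1r. Qed.

(** Here [s] and [m] stand for the two dimensions minus one. The prefactors [1/2] of the three
    masses leave 2, and the powers of [k] leave [k^(-1/2) = sigma sqrt 2]; together they are
    [sigma 2^(3/2)]. The power of [l] supplies the powers of the two dimensions. *)
Lemma ratio_constant (s m : nat) (sigma K : R) :
  let k := (sigma ^+ 2 *+ 2)^-1 in
  0 < sigma -> 0 < K -> (\int[mu]_x (gauss k x)%:E = K%:E)%E ->
  rmass k (s + m).+2 * Num.sqrt (s.+1%:R / m.+1%:R) ^+ s.+1 / (rmass k s * rmass k m) =
  sigma * (2 `^ (3 / 2) * s.+1%:R `^ (s.+1%:R / 2) * Gamma ((s.+1%:R + m.+1%:R + 1) / 2))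
    * m.+1%:R `^ (- (s.+1%:R / 2)) / (Gamma (m.+1%:R / 2) * Gamma (s.+1%:R / 2)).
Proof.
move=> k sg0 K0 KE.
have k0 : 0 < k by rewrite invr_gt0 pmulrn_lgt0 ?exprn_gt0.
rewrite !rmass_Gamma//.
have -> : (s.+1%:R + m.+1%:R + 1) / 2 = (s + m).+3%:R / 2 :> R.
  by congr (_ / _); rewrite -!natr1 natrD; ring.
have G1 := Gamma_gt0 K0 KE s k0; have G2 := Gamma_gt0 K0 KE m k0.
have k12 : k `^ (- ((s + m).+3%:R / 2)) =
    k `^ (- (s.+1%:R / 2)) * k `^ (- (m.+1%:R / 2)) * (sigma * Num.sqrt 2).
  have -> : sigma * Num.sqrt 2 = k `^ (- 2^-1).
    rewrite -powR_invr ?ltW// invrK powR12_sqrt; last by rewrite mulrn_wge0// sqr_ge0.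
    have -> : sigma ^+ 2 *+ 2 = sigma ^+ 2 * 2 by rewrite mulr_natr.
    by rewrite sqrtrM ?sqr_ge0// sqrtr_sqr gtr0_norm.
  rewrite -!powRD ?(gt_eqF k0) ?implybT//; congr (_ `^ _).
  by rewrite -!natr1 natrD; field.
have -> : (2 : R) `^ (3 / 2) = 2 * Num.sqrt 2.
  rewrite (_ : 3 / 2 = 1 + 2^-1 :> R); last by field.
  by rewrite powRD ?pnatr_eq0 ?implybT// powRr1// powR12_sqrt.
rewrite sqrt_exprn; last by rewrite divr_ge0.
rewrite k12 powRM ?invr_ge0// (powR_invr _ (ler0n R m.+1)).
move: (Gamma _) (Gamma _) (Gamma _) G1 G2 => A B D B0 D0.
have P1 : 0 < k `^ (- (s.+1%:R / 2)) by rewrite powR_gt0.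
have P2 : 0 < k `^ (- (m.+1%:R / 2)) by rewrite powR_gt0.
by field; rewrite !gt_eqF.
Qed.

(** Factor the residual dimension out of the base on the left; dimensions are again shifted by
    one. *)
Lemma density_conversion (s m : nat) (x : R) :
  m.+1%:R `^ (m.+1%:R / 2) / (s.+1%:R * x ^+ 2 + m.+1%:R) `^ ((s.+1%:R + m.+1%:R + 1) / 2) =
  m.+1%:R `^ (- (s.+2%:R / 2)) *
  (Num.sqrt (1 + (Num.sqrt (s.+1%:R / m.+1%:R) * x) ^+ 2))^-1 ^+ (s + m).+3 :> R.
Proof.
have -> : (s.+1%:R + m.+1%:R + 1) / 2 = (s + m).+3%:R / 2 :> R.
  by congr (_ / _); rewrite -!natr1 natrD; ring.
have y0 : 0 < s.+1%:R * x ^+ 2 + m.+1%:R by rewrite ltr_wpDl ?ltr0Sn// mulr_ge0 ?sqr_ge0 ?ler0n.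
have -> : 1 + (Num.sqrt (s.+1%:R / m.+1%:R) * x) ^+ 2 =
    (s.+1%:R * x ^+ 2 + m.+1%:R) / m.+1%:R.
  rewrite exprMn sqr_sqrtr ?divr_ge0//.
  have : 0 < m.+1%:R :> R by [].
  by move: (m.+1%:R : R) => M M0; field; rewrite gt_eqF.
rewrite exprVn sqrt_exprn ?divr_ge0 ?(ltW y0)// powRM ?invr_ge0 ?(ltW y0)//.
have -> : m.+1%:R `^ (m.+1%:R / 2) =
    m.+1%:R `^ (- (s.+2%:R / 2)) * m.+1%:R `^ ((s + m).+3%:R / 2) :> R.
  rewrite -powRD ?pnatr_eq0 ?implybT//; congr (_ `^ _).
  by rewrite -!natr1 natrD; field.
by rewrite (powR_invr _ (ler0n R m.+1)) (powRN m.+1%:R ((s + m).+3%:R / 2)) invfM invrK -mulrA (mulrC (_ `^ _)^-1).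
Qed.

End constants.

(** * From the regression model to two independent norms *)

Section main_expectation.
Context d (T : measurableType d) (R : realType) (P : probability T R).
Local Notation mu := (@lebesgue_measure R).

(** [k] is the rate [1 / (2 sigma^2)] and [K] the inverse peak of the normal density. The Gaussian
    integral on which all masses rest is read off from that density having total mass 1. *)
Lemma normal_iid_indep_density n (sigma : R) (eps : 'I_n -> T -> R) :
  0 < sigma -> normal_iid_vector P sigma eps ->
  let k := (sigma ^+ 2 *+ 2)^-1 in let K := (normal_peak sigma)^-1 in
  [/\ 0 < K, (\int[mu]_x (gauss k x)%:E = K%:E)%E &
    indep_density P finset.setT eps (fun _ x => gauss k x / K)].
Proof.
move=> sg0 [me law ind] k K.
have s0 : sigma != 0 by rewrite gt_eqF.
have K0 : 0 < K by rewrite invr_gt0 normal_peak_gt0.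
have pdfE x : normal_pdf 0 sigma x = gauss k x / K.
  rewrite normal_pdfE// /normal_fun /gauss /K invrK mulrC subr0 mulNr.
  by rewrite (mulrC k).
have mpdf : measurable_fun setT (fun x => gauss k x / K).
  by apply: measurable_funM => //; exact: measurable_gauss.
have I1 : (\int[mu]_x (gauss k x / K)%:E = 1)%E.
  by rewrite -(integral_normal_pdf 0 sigma); apply: eq_integral => x _; rewrite pdfE.
split => //.
- transitivity (\int[mu]_x (K%:E * (gauss k x / K)%:E))%E.
    by apply: eq_integral => x _; rewrite -EFinM; congr EFin; field; rewrite gt_eqF.
  rewrite ge0_integralZl//.
  + by rewrite I1 mule1.
  + exact/measurable_EFinP.
  + by move=> x _; rewrite lee_fin divr_ge0 ?gauss_ge0 ?ltW.
  + by rewrite lee_fin ltW.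
- split => //.
  + by move=> _ x; rewrite divr_ge0 ?gauss_ge0 ?ltW.
  + move=> B mB; rewrite (_ : [set w | _] = [set w | forall i, B i (eps i w)]); last first.
      by apply/seteqP; split => w /= h i; [apply: h; rewrite inE|move=> _; exact: h].
    rewrite ind//; apply: eq_big => [i|i _]; first by rewrite inE.
    by rewrite law// /normal_prob; apply: eq_integral => x _; rewrite pdfE.
Qed.

Lemma indep_density_givens n (k K : R) (E : 'I_n -> T -> R) (i j : 'I_n) (c s : R) (O : 'M[R]_n) :
  i != j -> c ^+ 2 + s ^+ 2 = 1 ->
  indep_density P finset.setT (fun l w => (O *m \col_u E u w) l 0) (fun _ x => gauss k x / K) ->
  indep_density P finset.setT (fun l w => (givens i j c s *m O *m \col_u E u w) l 0)
    (fun _ x => gauss k x / K).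
Proof.
move=> ij cs1 zO.
have iT : i \in [set: 'I_n]%SET by rewrite inE.
have jT : j \in [set: 'I_n]%SET by rewrite inE.
apply: eq_indep_density (indep_density_rotation (k := k) (K := K) zO iT jT ij cs1 _ _) => //.
move=> l w; rewrite /upd -mulmxA givens_mulE//.
have [->|lj] := eqVneq l j; first by rewrite eq_sym (negbTE ij).
by case: ifP.
Qed.

Section regression_statistics.
Variables (n p s : nat) (X : 'M[R]_(n, p)) (C : 'M[R]_(p, s)) (t : 'cV[R]_s)
  (beta : 'cV[R]_p) (sigma : R) (eps : 'I_n -> T -> R).
Hypotheses (pn : (p < n)%N) (rX : \rank X = p) (s0 : (0 < s)%N) (rC : \rank C = s)
  (sg0 : 0 < sigma) (eps_iid : normal_iid_vector P sigma eps)
  (tau0 : C^T *m beta - t = 0).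
Local Notation m := (n - p)%N.
Local Notation Y := (model_Y X beta eps).
Local Notation k := ((sigma ^+ 2 *+ 2)^-1).
Local Notation l := (Num.sqrt (s%:R / m%:R) : R).

(** In rotated coordinates [Sigmahat * sqrt m] is the norm [v] of the last [m] errors and [sqrt F]
    is [u / (l v)], with [u] the norm of the first [s]. A norm of [j] coordinates has exponent
    [j - 1], whence [s.-1] and [m.-1]. *)
Lemma expectation_Sigmahat_F (h : R -> R -> \bar R) :
  measurable_fun setT (fun z : R * R => h z.1 z.2) -> (forall x y, 0 <= h x y)%E ->
  (\int[P]_w h (Sigmahat X (Y w) * Num.sqrt m%:R)%R (Num.sqrt (Fstat C t X (Y w))) =
   \int[mu]_u \int[mu]_v (h v (u / (l * v))%R * (rpdf k s.-1 u * rpdf k m.-1 v)%:E))%E.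
Proof.
move=> mh h0.
have [K0 KE zeps] := normal_iid_indep_density sg0 eps_iid.
set K := (normal_peak sigma)^-1 in K0 KE zeps.
have [|i j c u O ij cu QO|O [QO O1 OX OH]] := @orthogonal_canonical_form R n p s X C
  (fun O => indep_density P finset.setT (fun i w => (O *m \col_u eps u w) i 0)
     (fun _ x => gauss k x / K)).
- by apply: eq_indep_density zeps => // i w; rewrite mul1mx mxE.
- exact: indep_density_givens.
pose A1 := [set i : 'I_n | (i < s)%N]%SET; pose A2 := [set i : 'I_n | (p <= i)%N]%SET.
have sp : (s <= p)%N := rank_le_cols rC.
have cA1 : #|A1| = s.
  rewrite -sum1_card (eq_bigl (fun i : 'I_n => (i < s)%N)) => [|i]; last by rewrite inE.
  by rewrite -(big_ord_widen _ (fun=> 1%N)) ?sum_nat_const ?card_ord ?muln1// (leq_trans sp)// ltnW.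
have cA2 : #|A2| = m.
  have -> : A2 = ~: [set i : 'I_n | (i < p)%N]%SET by apply/setP => i; rewrite !inE leqNgt.
  rewrite cardsCs finset.setCK card_ord; congr (_ - _)%N.
  rewrite -sum1_card (eq_bigl (fun i : 'I_n => (i < p)%N)) => [|i]; last by rewrite inE.
  by rewrite -(big_ord_widen _ (fun=> 1%N)) ?sum_nat_const ?card_ord ?muln1// ltnW.
have m0 : (0 < m)%N by rewrite subn_gt0.
pose H (z : R * R) := h z.2 (z.1 / (l * z.2)).
have mH : measurable_fun setT H.
  apply: (measurable_comp2 (H := fun z : R * R => h z.1 z.2)) => //.
  apply: measurable_funM => //.
  by apply: (measurableT_comp (@measurable_invr R)); apply: measurable_funM.
have H0 z : (0 <= H z)%E by exact: h0.
have A12 j : j \in A2 -> j \notin A1.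
  by rewrite !inE -leqNgt => pj; exact: leq_trans pj.
have := indep_density_two_norms K0 KE (A1 := A1) (A2 := A2) QO _ _ A12 mH H0.
rewrite cA1 cA2 => /(_ s0 m0) <-; apply: eq_integral => w _; rewrite /H/=.
have YE : Y w = X *m beta + \col_i eps i w by [].
set Z := O *m _.
have E1 : \sum_(j in A1) Z j 0 ^+ 2 = \sum_(i < n | (i < s)%N) Z i 0 ^+ 2.
  by apply: eq_bigl => i; rewrite inE.
have E2 : \sum_(j in A2) Z j 0 ^+ 2 = \sum_(i < n | (p <= i)%N) Z i 0 ^+ 2.
  by apply: eq_bigl => i; rewrite inE.
have sq_ge0 (A : {set 'I_n}) : 0 <= \sum_(j in A) Z j 0 ^+ 2.
  by apply: sumr_ge0 => i _; exact: sqr_ge0.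
have SE : Sigmahat2 X (Y w) = (\sum_(j in A2) Z j 0 ^+ 2) / m%:R.
  by rewrite /Sigmahat2 YE (residual_norm rX beta (\col_i eps i w) O1 OX) E2.
have FE : Fstat C t X (Y w) =
    (\sum_(j in A1) Z j 0 ^+ 2 / s%:R) / (\sum_(j in A2) Z j 0 ^+ 2 / m%:R).
  by rewrite /Fstat SE -!mulr_suml YE (tauhat_norm rX rC (\col_i eps i w) O1 tau0 OH) E1.
have mV : Num.sqrt (m%:R : R) != 0 by rewrite gt_eqF// sqrtr_gt0 ltr0n.
congr (h _ _).
  rewrite /Sigmahat SE sqrtrM// sqrtrV ?ler0n// divfK//.
(* The identity holds pointwise even for a zero residual, since inverses of products split also at
   0. *)
rewrite FE -!mulr_suml !sqrtrM ?sqrtrV ?mulr_ge0 ?invr_ge0 ?ler0n//.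
rewrite (sqrtrM _ (sq_ge0 A2)) (sqrtrV (ler0n R m)) !invfM !invrK.
ring.
Qed.

End regression_statistics.

End main_expectation.

(** * The law of sqrt F weighted by the residual norm *)

Section half_line_density.
Context {R : realType}.
Local Notation mu := (@lebesgue_measure R).
Variables (k K l : R) (N1 N2 : nat).
Hypotheses (K0 : 0 < K) (KE : (\int[mu]_x (gauss k x)%:E = K%:E)%E) (l0 : 0 < l).

(** Up to the factor [ratio_mass], the density of sqrt F weighted by the residual norm; unweighted,
    the last exponent would be [(N1 + N2).+2]. *)
Definition ratio_density (x : R) : R :=
  x ^+ N1 * (Num.sqrt (1 + (l * x) ^+ 2))^-1 ^+ (N1 + N2).+3.

Lemma ratio_density_ge0 (x : R) : 0 <= x -> 0 <= ratio_density x.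
Proof. by move=> x0; rewrite mulr_ge0 ?exprn_ge0// invr_ge0 sqrtr_ge0. Qed.

Lemma measurable_ratio_density : measurable_fun setT ratio_density.
Proof.
apply: measurable_funM; first exact: measurable_funX.
apply: measurable_funX; apply: (measurableT_comp (@measurable_invr R)).
apply: (measurableT_comp measurable_sqrtr1D); exact: measurable_funM.
Qed.

Definition ratio_mass : R :=
  rmass k (N1 + N2).+2 * l ^+ N1.+1 / (rmass k N1 * rmass k N2).

Lemma ratio_mass_gt0 : 0 < ratio_mass.
Proof. by rewrite divr_gt0 ?mulr_gt0 ?exprn_gt0 ?(rmass_gt0 K0 KE). Qed.

(** The case [g = 1] of [integral_ratio_rpdf]: the left side is the first moment of the residual
    norm, a positive real, so the integral on the right is neither zero nor infinite. *)
Lemma ratio_density_mass : exists2 r : R, 0 < r &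
  (\int[mu]_(x in `]0%R, +oo[) (ratio_density x)%:E = r%:E)%E.
Proof.
have := integral_ratio_rpdf K0 KE N1 N2 l0 (measurable_cst (1%E : \bar R)) (fun=> lee01).
under eq_integral do under eq_integral do rewrite mul1e.
rewrite (integral_rpdf_moment K0 KE) -/ratio_mass.
under [in RHS]eq_integral do rewrite mul1e.
have c0 := ratio_mass_gt0.
have r0 : 0 < rmass k N2.+1 / rmass k N2 by rewrite divr_gt0 ?(rmass_gt0 K0 KE).
rewrite /ratio_density; case: (\int[mu]_(x in _) _)%E => [r| |].
- by move=> [E]; exists r => //; rewrite -(pmulr_rgt0 _ c0) -E.
- by rewrite mulry gtr0_sg// mul1e.
- by rewrite mulrNy gtr0_sg// mul1e.
Qed.

Lemma integrable_ratio_density (f : R -> R) (B : R) :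
  measurable_fun setT f -> (forall x, 0 < x -> `|f x| <= B) ->
  mu.-integrable `]0, +oo[ (EFin \o (fun x => f x * ratio_density x)).
Proof.
move=> mf fB; have [r _ rE] := ratio_density_mass.
have B0 : 0 <= B by apply: le_trans (fB 1 ltr01).
have iB : mu.-integrable `]0, +oo[ (EFin \o (fun x => B * ratio_density x)).
  apply/integrableP; split.
    by apply/measurable_EFinP/measurable_funTS/measurable_funM => //; exact: measurable_ratio_density.
  rewrite [X in (X < _)%E](_ : _ = \int[mu]_(x in `]0%R, +oo[) (B%:E * (ratio_density x)%:E))%E; last first.
    apply: eq_integral.
    move=> x; rewrite inE/= in_itv/= andbT => x0.
    by rewrite ger0_norm -?EFinM// mulr_ge0// ratio_density_ge0// ltW.
  rewrite ge0_integralZl//.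
  - by rewrite rE -EFinM ltry.
  - by apply/measurable_EFinP/measurable_funTS; exact: measurable_ratio_density.
  - by move=> x; rewrite /= in_itv/= andbT => x0; rewrite lee_fin ratio_density_ge0 ?ltW.
apply: le_integrable iB => //.
- by apply/measurable_EFinP/measurable_funTS/measurable_funM => //; exact: measurable_ratio_density.
- move=> x; rewrite /= in_itv/= andbT => x0.
  rewrite lee_fin !normrM ler_wpM2r// (ger0_norm B0); exact: fB.
Qed.

End half_line_density.

Theorem theorem2 (R : realType) (dsp : measure_display) (T : measurableType dsp)
  (P : probability T R) (n p s : nat) (alpha : R)
  (X : 'M[R]_(n, p)) (a : 'cV[R]_p) (C : 'M[R]_(p, s)) (t : 'cV[R]_s)
  (beta : 'cV[R]_p) (sigma : R) (eps : 'I_n -> T -> R)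
  (tm k : R) (dd : R -> R) :
  0 < alpha < 1 ->
  (p < n)%N -> \rank X = p ->
  (0 < s)%N -> (s < p)%N -> \rank C = s ->
  a != 0 -> ~~ (a^T <= C^T)%MS ->
  0 < sigma -> normal_iid_vector P sigma eps ->
  (forall j : 'I_s,
     Expect P (fun w =>
       (tauhat C t X (model_Y X beta eps w) j 0 - (C^T *m beta - t) j 0)
       * (Thetahat a X (model_Y X beta eps w) - (a^T *m beta) 0 0)) = 0) ->
  Rintegral lebesgue_measure `[- tm, tm] (student_pdf (n - p)) = 1 - alpha ->
  0 < k ->
  {within `[0, +oo[, continuous dd} ->
  (forall x, 0 <= x -> 0 < dd x) ->
  (forall x, k <= x -> dd x = tm) ->
  C^T *m beta - t = 0 ->
  let m := (n - p)%N in
  let EW := Expect P (fun w => Sigmahat X (model_Y X beta eps w) / sigma) in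
  scaled_exp_length P a C t dd tm X (model_Y X beta eps)
  = 1 + (2 `^ (3 / 2) * s%:R `^ (s%:R / 2) * Gamma ((s%:R + m%:R + 1) / 2))
        / (tm * EW * Gamma (m%:R / 2) * Gamma (s%:R / 2))
      * Rintegral lebesgue_measure `[0, k]
          (fun x => (dd x - tm) * x ^+ (s - 1)
             * (m%:R `^ (m%:R / 2) / (s%:R * x ^+ 2 + m%:R) `^ ((s%:R + m%:R + 1) / 2))).
Proof.
move=> _ pn rX s0 sp rC a0 _ sg0 iid _ _ k0 cdd dd0 ddtm tau0 m EW.
have tm0 : 0 < tm by rewrite -(ddtm k)// dd0// ltW.
have m0 : (0 < m)%N by rewrite subn_gt0.
have [K0 KE _] := normal_iid_indep_density sg0 iid.
set c := (sigma ^+ 2 *+ 2)^-1 in KE.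
pose mu := @lebesgue_measure R.
pose l : R := Num.sqrt (s%:R / m%:R).
have l0 : 0 < l by rewrite sqrtr_gt0 divr_gt0 ?ltr0n.
pose rho := ratio_density l s.-1 m.-1.
pose cst0 := ratio_mass c l s.-1 m.-1.
have cst_gt0 : 0 < cst0 by exact: (ratio_mass_gt0 _ _ K0 KE).
have sm0 : 0 < Num.sqrt (m%:R : R) by rewrite sqrtr_gt0 ltr0n.
pose Y := model_Y X beta eps.
have Sg0 w : 0 <= Sigmahat X (Y w) by exact: sqrtr_ge0.
have law (g : R -> R) : measurable_fun setT g -> (forall x, 0 <= g x) ->
    Expect P (fun w => Sigmahat X (Y w) * g (Num.sqrt (Fstat C t X (Y w)))) =
    cst0 * \int[mu]_(x in `]0, +oo[) (g x / Num.sqrt m%:R * rho x).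
  move=> mg g0.
  pose h (v x : R) : \bar R := ((g x / Num.sqrt m%:R)%:E * `|v|%:E)%E.
  have mgm : measurable_fun setT (fun x => (g x / Num.sqrt m%:R)%:E).
    by apply/measurable_EFinP/measurable_funM.
  have gm0 x : (0 <= (g x / Num.sqrt m%:R)%:E)%E by rewrite lee_fin divr_ge0 ?(ltW sm0).
  have mh : measurable_fun setT (fun z : R * R => h z.1 z.2).
    apply: emeasurable_funM; first exact: (measurableT_comp mgm).
    by apply/measurable_EFinP; apply: measurableT_comp; [exact: normr_measurable|].
  have h0 v x : (0 <= h v x)%E by rewrite mule_ge0// lee_fin.
  have E := etrans (expectation_Sigmahat_F pn rX s0 rC sg0 iid tau0 mh h0)
    (integral_ratio_rpdf K0 KE s.-1 m.-1 l0 mgm gm0).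
  rewrite /Expect /Rintegral.
  transitivity (fine (cst0%:E * \int[mu]_(x in `]0%R, +oo[) (g x / Num.sqrt m%:R * rho x)%:E)%E).
    congr fine; apply: etrans (etrans E _).
      apply: eq_integral => w _; rewrite /h -EFinM -/m -/(Y w); congr EFin.
      by rewrite ger0_norm ?mulr_ge0 ?(ltW sm0)//; field; rewrite gt_eqF.
    by congr (_ * _)%E; apply: eq_integral => x _; rewrite -EFinM.
  have : (0 <= \int[mu]_(x in `]0%R, +oo[) (g x / Num.sqrt m%:R * rho x)%:E)%E.
    apply: integral_ge0 => x; rewrite /= in_itv/= andbT => x0.
    by rewrite lee_fin mulr_ge0 ?divr_ge0 ?(ltW sm0)// ratio_density_ge0// ltW.
  (* An infinite integral is read as 0 on both sides, so [law] needs no integrability. *)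
  case: (\int[mu]_(x in `]0%R, +oo[) _)%E => [r| |]// _.
  by rewrite mulry gtr0_sg// mul1e/= mulr0.
(* [dd] is arbitrary on the negative half-line, hence possibly not measurable there. *)
pose G := dd \_ `[0, +oo[.
have mG : measurable_fun setT G.
  have mI : measurable (`[0, +oo[%classic : set R) by exact: measurable_itv.
  have mdd : measurable_fun (`[0, +oo[%classic : set R) dd.
    exact: subspace_continuous_measurable_fun.
  by apply/(measurable_restrictT dd mI).
have GE x : 0 <= x -> G x = dd x.
  by move=> x0; rewrite /G patchE mem_setE in_itv/= x0.
have G0 x : 0 <= G x.
  rewrite /G patchE mem_setE in_itv/= andbT; case: ifP => // x0; exact/ltW/dd0.
(* A continuous function is bounded on [[0, k]], and beyond [k] the value is [tm]. The bound makes
   all later integrals finite, so they may be subtracted. *)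
have [B GB] : exists B, forall x, 0 < x -> `|G x| <= B.
  have ck : {within `[0, k], continuous dd}.
    apply: continuous_subspaceW cdd => x /=; rewrite !in_itv/= andbT.
    by move=> /andP[].
  have [x1 _ x1max] := EVT_max (ltW k0) ck.
  exists (Num.max (dd x1) tm) => x x0; have x0' := ltW x0; rewrite GE// gtr0_norm ?dd0//.
  rewrite le_max; have [xk|kx] := leP x k.
    by rewrite x1max// in_itv/= xk x0'.
  by rewrite (ddtm x (ltW kx)) lexx orbT.
have irho f B' := @integrable_ratio_density R c (normal_peak sigma)^-1 l s.-1 m.-1 K0 KE l0 f B'.
have iGr : mu.-integrable `]0, +oo[ (EFin \o (fun x => G x * rho x)) by exact: irho GB.
have i1r (r : R) : mu.-integrable `]0, +oo[ (EFin \o (fun x => r * rho x)).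
  by apply: (irho (cst r) `|r|).
have ir : mu.-integrable `]0, +oo[ (EFin \o rho).
  by have := i1r 1; under [X in EFin \o X]eq_fun do rewrite mul1r.
pose i1 := \int[mu]_(x in `]0, +oo[) rho x.
pose iG := \int[mu]_(x in `]0, +oo[) (G x * rho x).
have i10 : 0 < i1.
  by have [r r0 rE] := ratio_density_mass s.-1 m.-1 K0 KE l0; rewrite /i1 /Rintegral rE.
(* [lawC] will serve both for E(W) and for the length of I, [lawG] for the length of J; [Thetahat]
   cancels in both lengths. *)
have lawC (r : R) : 0 <= r ->
    Expect P (fun w => Sigmahat X (Y w) * r) = cst0 * (r / Num.sqrt m%:R * i1).
  move=> r0; rewrite (law (cst r))//; congr (_ * _).
  by rewrite -RintegralZl.
have lawG (r : R) : 0 <= r ->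
    Expect P (fun w => Sigmahat X (Y w) * (r * G (Num.sqrt (Fstat C t X (Y w))))) =
    cst0 * (r / Num.sqrt m%:R * iG).
  move=> r0; rewrite (law (fun x => r * G x)); last 2 first.
  - exact: measurable_funM.
  - by move=> x; rewrite mulr_ge0.
  congr (_ * _); rewrite -RintegralZl//; apply: eq_Rintegral => x _; ring.
have v0 := v11_gt0 rX a0.
pose sv := Num.sqrt (v11 a X).
have sv0 : 0 < sv by rewrite sqrtr_gt0.
have EWE : EW = cst0 * (sigma^-1 / Num.sqrt m%:R * i1).
  by rewrite /EW lawC// invr_ge0 ltW.
have numE : Expect P (fun w => J_hi a C t dd X (Y w) - J_lo a C t dd X (Y w)) =
    cst0 * (2 * sv / Num.sqrt m%:R * iG).
  rewrite -lawG; last by rewrite mulr_ge0 ?ltW.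
  congr (Expect P _); apply/funext => w.
  by rewrite /J_hi /J_lo GE ?sqrtr_ge0// -/sv; ring.
have denE : Expect P (fun w => I_hi a tm X (Y w) - I_lo a tm X (Y w)) =
    cst0 * (2 * sv * tm / Num.sqrt m%:R * i1).
  rewrite -lawC; last by rewrite !mulr_ge0 ?ltW.
  congr (Expect P _); apply/funext => w.
  by rewrite /I_hi /I_lo -/sv; ring.
(* The power of [m] left after factoring [m] out of [s x^2 + m]. *)
pose q : R := m%:R `^ (- (s.+1%:R / 2)).
have conv (x : R) : m%:R `^ (m%:R / 2) /
      (s%:R * x ^+ 2 + m%:R) `^ ((s%:R + m%:R + 1) / 2) =
    q * (Num.sqrt (1 + (l * x) ^+ 2))^-1 ^+ (s.-1 + m.-1).+3.
  by have := density_conversion s.-1 m.-1 x; rewrite !prednK.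
have ifr : mu.-integrable `]0, +oo[ (EFin \o (fun x => (G x - tm) * rho x)).
  apply: (irho _ (B + tm)); first exact: measurable_funB.
  move=> x x0; apply: le_trans (ler_normB _ _) _.
  by rewrite (gtr0_norm tm0) lerD2r; exact: GB.
(* Beyond [k] the integrand is zero, so the half-line integral [iG - tm * i1] lives on []0, k]]. The
   quotient of lengths is [iG / (tm * i1)], that is, 1 plus this integral over [tm * i1]. *)
have intE : \int[mu]_(x in `]0, k]) ((G x - tm) * rho x) = iG - tm * i1.
  have ify : \int[mu]_(x in `]0, +oo[) ((G x - tm) * rho x) = iG - tm * i1.
    rewrite /i1 -RintegralZl// -RintegralB//.
    by apply: eq_Rintegral => x _; rewrite mulrBl.
  have := Rintegral_itvB (x := k) ifr; rewrite ify.
  have -> : \int[mu]_(x in `]k, +oo[) ((G x - tm) * rho x) = 0.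
    transitivity (\int[mu]_(x in `]k, +oo[) (cst 0 x : R)).
      apply: eq_Rintegral => x; rewrite inE/= in_itv/= andbT => kx.
      by rewrite GE ?ddtm ?subrr ?mul0r// ltW// (lt_trans k0).
    by rewrite /Rintegral integral0.
  by rewrite !bnd_simp => /(_ (ltW k0) isT)/eqP; rewrite subr_eq0 => /eqP.
have intE' : Rintegral mu `[0, k]
    (fun x => (dd x - tm) * x ^+ (s - 1) *
      (m%:R `^ (m%:R / 2) / (s%:R * x ^+ 2 + m%:R) `^ ((s%:R + m%:R + 1) / 2))) =
    q * (iG - tm * i1).
  rewrite -intE; transitivity (\int[mu]_(x in `[0, k]) (q * ((G x - tm) * rho x))).
    apply: eq_Rintegral.
    move=> x; rewrite inE/= in_itv/= => /andP[x0 _].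
    by rewrite conv GE// /rho /ratio_density subn1; ring.
  have sub : (`]0%R, k]%classic : set R) `<=` (`]0%R, +oo[%classic : set R).
    by move=> x /=; rewrite !in_itv/= andbT => /andP[].
  have ifk : mu.-integrable `]0, k] (EFin \o (fun x => (G x - tm) * rho x)).
    exact: integrableS ifr.
  rewrite -Rintegral_itv_obnd_cbnd ?RintegralZl//.
  by apply: (integrableZl _ q ifk); exact: measurable_itv.
rewrite /scaled_exp_length numE denE intE' EWE.
have := ratio_constant s.-1 m.-1 sg0 K0 KE; rewrite !prednK// -/c -/l.
(* Reconciles the power of [m] in [ratio_constant] with [q]; the extra [sqrt m] comes from the
   scaling between the residual norm and [Sigmahat]. *)
have qm : q * Num.sqrt m%:R = m%:R `^ (- (s%:R / 2)).
  rewrite -powR12_sqrt ?ler0n// /q -powRD; last by rewrite pnatr_eq0 -lt0n m0 implybT.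
  by congr (_ `^ _); rewrite -natr1; field.
have Gs : 0 < Gamma (s%:R / 2 : R).
  by have := Gamma_gt0 K0 KE s.-1; rewrite prednK//; apply; rewrite invr_gt0 pmulrn_lgt0 ?exprn_gt0.
have Gm : 0 < Gamma (m%:R / 2 : R).
  by have := Gamma_gt0 K0 KE m.-1; rewrite prednK//; apply; rewrite invr_gt0 pmulrn_lgt0 ?exprn_gt0.
have q0 : 0 < q by apply: powR_gt0; rewrite ltr0n.
rewrite -qm; set A := 2 `^ (3 / 2) * _ * _ => cE.
have {}cE : cst0 = sigma * A * (q * Num.sqrt m%:R) / (Gamma (m%:R / 2) * Gamma (s%:R / 2)).
  by rewrite -cE /cst0 /ratio_mass prednK.
(* [A] contains a third Gamma value; its being nonzero is read off from [cst0 > 0]. *)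
have A0 : A != 0.
  by apply: contraTneq cst_gt0 => A0; rewrite cE A0 mulr0 !mul0r ltxx.
rewrite cE; field.
by rewrite A0 !gt_eqF.
Qed.
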